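(* Assume that there exists some $\theta>0$ satisfying $\psi(\theta)<\infty$. If $\psi(0)>0$, then $$\lim_{n\to\infty}\frac1n\log\mathbb P(M_n\ge nx)=-\psi^*(x)\quad\text{for any }x>x^*.$$ If $\psi(0)\le 0$, then $$\lim_{n\to\infty}\frac1n\log\mathbb P(M_n\ge nx)=-\psi^*(x)\quad\text{for any }x>\frac{\mathbb E\big(\sum_{|u|=1}V(u)\big)}{\mathbb E(Z_1(\mathbb R))}\in\mathbb R\cup\{-\infty\}.$$
   Context: Branching random walk. $\mathbb N=\{1,2,\dots\}$, $\mathbb T=\bigcup_{n\ge0}\mathbb N^n$ with $\mathbb N^0=\{\varnothing\}$; for $u=(u^{(1)},\dots,u^{(n)})\in\mathbb N^n$, $|u|=n$ and $u_k=(u^{(1)},\dots,u^{(k)})$ for $k\le n$. Let $\mathcal L$ be a point process on $\mathbb R$ (the reproduction law). Let $(z^{(u)}_k)_{k\ge1}$, $u\in\mathbb T$, be i.i.d. random non-increasing sequences with values in $\mathbb R\cup\{-\infty\}$ such that $\sum_{k\ge1}\delta_{z^{(u)}_k}$ is distributed as $\mathcal L$ (with $\delta_{-\infty}:=0$). The branching random walk is $V(\varnothing)=0$, $V(u)=\sum_{i=1}^{|u|}z^{(u_{i-1})}_{u^{(i)}}$ (with $-\infty+x=-\infty$). Vertices with $V(u)=-\infty$ are dead; all sums and maxima over $|u|=n$ are over living vertices ($V(u)>-\infty$) only. $Z_n=\sum_{|u|=n}\delta_{V(u)}$, and $M_n=\max_{|u|=n}V(u)$, with $M_n=-\infty$ if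 no vertex is alive at generation $n$. It is assumed that $\mathbb P(Z_1(\mathbb R)=0)<1$. $\psi(\theta)=\log\mathbb E\big(\sum_{|u|=1}e^{\theta V(u)}\big)$, $\psi^*(x)=\sup_{\theta\ge0}\{\theta x-\psi(\theta)\}\in\mathbb R\cup\{+\infty\}$, and, when $\psi(0)>0$, $x^*=\inf_{\theta>0}\psi(\theta)/\theta=\sup\{x\in\mathbb R:\psi^*(x)<0\}$. Convention $\log 0=-\infty$. *)

(* Defs.v *)
From HB Require Import structures.
From mathcomp Require Import all_boot all_order all_algebra.
From mathcomp Require Import all_classical all_reals all_analysis.
From mathcomp Require Import measurable_realfun.

Set Implicit Arguments.
Unset Strict Implicit.
Unset Printing Implicit Defensive.
Import Order.TTheory GRing.Theory Num.Theory.
Import numFieldNormedType.Exports.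

Local Open Scope classical_set_scope.
Local Open Scope ring_scope.
Local Open Scope ereal_scope.

(* The sigma-algebra on [I -> \bar R] generated by the evaluations at the
   points of [D].  For [I = nat] and [D = setT] it is the product sigma-algebra
   on sequences; for [I = set R] and [D = measurable] it is the usual
   sigma-algebra on a space of measures on [R]. *)
Definition eval_sigma (R : realType) (I : Type) (D : set I) :
    set (set (I -> \bar R)) :=
  <<s \bigcup_(i in D)
        preimage_set_system setT (fun f : I -> \bar R => f i)
          (@measurable _ (\bar R)) >>.

(* Random elements of [E], where [S] is the sigma-algebra carried by [E]. *)
Definition same_law (R : realType) (d1 d2 : measure_display)
    (T1 : measurableType d1) (T2 : measurableType d2)
    (P1 : probability T1 R) (P2 : probability T2 R)
    (E : Type) (S : set (set E)) (X1 : T1 -> E) (X2 : T2 -> E) : Prop :=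
  forall B, S B -> P1 (X1 @^-1` B) = P2 (X2 @^-1` B).

Definition mutually_independent (R : realType) (d : measure_display)
    (T : measurableType d) (P : probability T R)
    (I : eqType) (E : Type) (S : set (set E)) (X : I -> T -> E) : Prop :=
  forall (s : seq I) (B : I -> set E), uniq s -> (forall i, S (B i)) ->
    P (\bigcap_(i in [set` s]) (X i @^-1` B i)) =
    \prod_(i <- s) P (X i @^-1` B i).

(* A random measure is a kernel from the probability space to [R]; it is a
   point process when it is integer-valued and finite on bounded sets.  (On an
   unbounded set the value is then, by sigma-additivity, an integer or +oo.) *)
Definition point_process (R : realType) (d : measure_display)
    (T : measurableType d) (L : R.-ker T ~> measurableTypeR R) : Prop :=
  forall (w : T) (a b : R) (A : set (measurableTypeR R)),
    measurable A -> A `<=` `[a, b] -> exists k : nat, L w A = k%:R%:E.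

(* Dirac mass at [x], with the convention that the mass at -oo is null. *)
Definition mass (R : realType) (x : \bar R) (A : set (measurableTypeR R)) :
    \bar R :=
  if x is r%:E then \d_(r : measurableTypeR R) A else 0.

Definition sum_masses (R : realType) (s : nat -> \bar R)
    (A : set (measurableTypeR R)) : \bar R :=
  \sum_(0 <= k <oo) mass (s k) A.

(* Vertices are finite words over [nat]: the children of a vertex are numbered
   from 0, that is, the letter [k] stands for the (k+1)-st child. *)
Definition vertex : Type := seq nat.

Section BranchingRandomWalk.
Context (R : realType) (d : measure_display) (T : measurableType d).
Context (P : probability T R) (z : vertex -> T -> nat -> \bar R).

Record reproduction_family (d' : measure_display) (T' : measurableType d')
    (P' : probability T' R) (L : R.-ker T' ~> measurableTypeR R) : Prop := {
  rf_point_process : point_process L ;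
  rf_measurable : forall u k, measurable_fun setT (fun w => z u w k) ;
  rf_lt_pinfty : forall u w k, z u w k < +oo ;
  rf_nonincreasing : forall u w, nonincreasing_seq (z u w) ;
  rf_independent : mutually_independent P (eval_sigma setT) z ;
  rf_identically_distributed :
    forall u v, same_law P P (eval_sigma setT) (z u) (z v) ;
  rf_law : forall u, same_law P P'
    (eval_sigma (@measurable _ (measurableTypeR R)))
    (fun w => sum_masses (z u w)) (fun w => (L w : set _ -> \bar R)) }.

Definition V (w : T) (u : vertex) : \bar R :=
  \sum_(i < size u) z (take i u) w (nth 0%N u i).

Definition generation (n : nat) : set vertex := [set u | size u = n].

Definition living (n : nat) (w : T) : set vertex :=
  generation n `&` [set u | V w u != -oo].

Definition Z (n : nat) (w : T) (A : set (measurableTypeR R)) : \bar R :=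
  \esum_(u in generation n) mass (V w u) A.

Definition M (n : nat) (w : T) : \bar R :=
  ereal_sup [set V w u | u in living n w].

(* [\esum] is only meaningful for nonnegative terms, hence the splitting. *)
Definition sum_positions (n : nat) (w : T) : \bar R :=
  \esum_(u in living n w) (V w)^\+ u - \esum_(u in living n w) (V w)^\- u.

Definition psi (theta : R) : \bar R :=
  lne (\int[P]_w \esum_(u in living 1 w) expeR (theta%:E * V w u)).

Definition psi_star (x : R) : \bar R :=
  ereal_sup [set (theta * x)%:E - psi theta
            | theta in [set theta : R | (0 <= theta)%R]].

Definition x_star : \bar R :=
  ereal_inf [set psi theta / theta%:E
            | theta in [set theta : R | (0 < theta)%R]].

Definition mean_position : \bar R :=
  (\int[P]_w sum_positions 1 w) / (\int[P]_w Z 1 w setT).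

Definition log_tail_rate (x : R) (n : nat) : \bar R :=
  (n%:R^-1)%:E * lne (P [set w | (n%:R * x)%:E <= M n w]).

End BranchingRandomWalk.

(* Main.v *)
(* Upper bound: exp(theta M_n) is at most the sum over |u| = n of
   exp(theta V(u)), whose expectation is the n-th power of its value for n = 1;
   conclude by Markov's inequality.

   Lower bound: keep finitely many children and round displacements down to
   finitely many values.  The probability q_n(y) that a descendant reaches y at
   generation n then satisfies q_{n+1}(y) = 1 - E prod_i (1 - q_n(y - z_i)),
   which is nearly linear while q_n is small.  Let theta0 >= 0 minimise
   theta |-> E sum_i exp(theta (z_i - x)), with minimum m.  The law tilted by
   theta0 has drift x (at least x if theta0 = 0), so that a wide bump b makes
   phi(y) = exp(- theta0 y) b(kappa y) satisfy E sum_i phi(y + x - z_i) >=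
   (m - eps) phi(y), and c rho^n phi(y) remains below q_n(n x + y) for every
   rho <= 1 with rho < m.  By compactness in theta, the minimum of the truncated
   transform tends to exp(- psi_star x) as the truncation is removed.  If no
   displacement exceeds x, the walk must follow the atom at x, whose mass is the
   limit of the transform as theta tends to infinity, and phi is the indicator
   of (-oo, 0].  Both assumptions on x are used only through psi_star x >= 0,
   which makes rho <= 1 harmless. *)
Require Import Defs.
From mathcomp Require Import all_boot all_order all_algebra.
From mathcomp Require Import all_classical all_reals all_analysis.
From mathcomp Require Import measurable_realfun ring lra.

Set Implicit Arguments.
Unset Strict Implicit.
Unset Printing Implicit Defensive.
Import Order.TTheory GRing.Theory Num.Theory.
Import numFieldNormedType.Exports.

Local Open Scope classical_set_scope.
Local Open Scope ring_scope.

(** * A test function for the linearised recursion *)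

Section Bump.
Variable R : realType.
Implicit Types (s t : R).

(** Its square is a compactly supported bump of class C^1, whose derivative on the support is
    [- 4 * s * quartic_bump_base s]. *)
Definition quartic_bump_base s : R := Num.max 0 (1 - s ^+ 2).
Definition quartic_bump s : R := quartic_bump_base s ^+ 2.

(** The second-order error is relative to the bump itself, which is what a multiplicative loss in
    the recursion requires. This is possible because the bump is convex near the ends of its
    support, where it vanishes. *)
Lemma quartic_bump_taylor s t : `|t| <= 2^-1 ->
  (1 - 4 * t ^+ 2) * quartic_bump s - 4 * s * quartic_bump_base s * t <= quartic_bump (s + t).
Proof.
rewrite ler_norml => /andP[t1 t2]; rewrite /quartic_bump /quartic_bump_base.
have [|s1] := leP (1 - s ^+ 2) 0; first by rewrite !expr2; nra.
set u := 1 - s ^+ 2 in s1 *.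
have us : s ^+ 2 = 1 - u by rewrite /u; ring.
have u1 : u <= 1 by rewrite /u; nra.
have tt : t ^+ 2 <= 4^-1 by nra.
have [v0|v0] := leP (1 - (s + t) ^+ 2) 0.
- have {}v0 : u <= 2 * s * t + t ^+ 2 by rewrite /u; nra.
  suff h : (1 - 4 * t ^+ 2) * u <= 4 * s * t.
    have := ler_wpM2r (ltW s1) h; rewrite !expr2; lra.
  (* If [2 t^2 <= u], doubling [v0] gives [u <= 4 s t]. Otherwise [s^2 >= 1/2] forces [|t| <= |s|];
     then [s t >= t^2], so [u < 2 t^2 <= 2 s t]. *)
  have [h|h] := leP (2 * t ^+ 2) u; first by nra.
  have s2 : 2^-1 <= s ^+ 2 by lra.
  have st : 0 <= s * t.
    rewrite leNgt; apply/negP => st.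
    have : - (s * t) * 2 <= t ^+ 2 by lra.
    have : t ^+ 2 <= - (s * t).
      have -> : - (s * t) = `|s| * `|t| by rewrite -normrM ltr0_norm.
      have -> : t ^+ 2 = `|t| * `|t| by rewrite -expr2 real_normK// num_real.
      apply: ler_wpM2r => //.
      rewrite -(@ler_pXn2r _ 2) ?nnegrE// !real_normK ?num_real//; lra.
    lra.
  have : t ^+ 2 <= s * t.
      have -> : (s * t) = `|s| * `|t| by rewrite -normrM ger0_norm.
      have -> : t ^+ 2 = `|t| * `|t| by rewrite -expr2 real_normK// num_real.
      apply: ler_wpM2r => //.
      rewrite -(@ler_pXn2r _ 2) ?nnegrE// !real_normK ?num_real//; lra.
  nra.
- have -> : 1 - (s + t) ^+ 2 = u - 2 * s * t - t ^+ 2 by rewrite /u; ring.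
  have -> : (u - 2 * s * t - t ^+ 2) ^+ 2 =
     (1 - 4 * t ^+ 2) * u ^+ 2 - 4 * s * u * t +
     t ^+ 2 * ((2 * s + t) ^+ 2 - 2 * u + 4 * u ^+ 2) by ring.
  suff : 0 <= (2 * s + t) ^+ 2 - 2 * u + 4 * u ^+ 2.
    by move=> h; rewrite lerDl mulr_ge0// sqr_ge0.
  (* For [u >= 1/2] the terms in [u] are nonnegative by themselves; for [u < 1/2], [s^2 > 1/2] makes
     [(2 s + t)^2] large enough. *)
  have [h|h] := leP 2^-1 u.
    by have := sqr_ge0 (2 * s + t); nra.
  have := sqr_ge0 (2 * s + 2 * t); have := sqr_ge0 (1 - 2 * u).
  rewrite !expr2 in us tt *; lra.
Qed.
End Bump.

(** * Minimisation of a finite Laplace transform, and tilting *)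

Section Laplace.
Variables (R : realType) (J : finType) (w d : J -> R).
Hypothesis w_ge0 : forall j, 0 <= w j.

Definition laplace (theta : R) : R := \sum_j w j * expR (theta * d j).

Let B : R := 1 + \sum_j `|d j|.

Let B_gt0 : 0 < B. Proof. by rewrite ltr_pwDl// sumr_ge0. Qed.

Let d_le j : `|d j| <= B.
Proof.
rewrite /B (bigD1 j)//= addrCA lerDl addr_ge0// sumr_ge0// => *; exact: normr_ge0.
Qed.

Lemma expR_le_quad (x : R) : `|x| <= 2^-1 -> expR x <= 1 + x + 2 * x ^+ 2.
Proof.
rewrite ler_norml => /andP[x1 x2].
have h := expR_ge1Dx (- x); have x0 := expR_gt0 x.
have {}h : (1 - x) * expR x <= 1.
  by rewrite (le_trans (ler_wpM2r (ltW x0) h))// -expRD addNr expR0.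
have : 1 <= (1 - x) * (1 + x + 2 * x ^+ 2).
  have -> : (1 - x) * (1 + x + 2 * x ^+ 2) = 1 + x ^+ 2 * (1 - 2 * x) by ring.
  by rewrite lerDl mulr_ge0 ?sqr_ge0//; lra.
move=> /(le_trans h); rewrite ler_pM2l//; lra.
Qed.

(** [S] is the derivative of the transform at [theta0], so these are the first-order conditions on a
    half-line. The quadratic bound on [expR] takes the place of differentiation. *)
Lemma laplace_first_order (theta0 : R) : 0 <= theta0 ->
    (forall theta : R, 0 <= theta -> laplace theta0 <= laplace theta) ->
  let S := \sum_j w j * expR (theta0 * d j) * d j in
  0 <= S /\ (0 < theta0 -> S = 0).
Proof.
move=> t0 tmin S.
pose Q := \sum_j w j * expR (theta0 * d j) * d j ^+ 2.
have Q0 : 0 <= Q.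
  rewrite /Q; apply: sumr_ge0 => j _; apply: mulr_ge0 (sqr_ge0 _).
  by rewrite mulr_ge0 ?expR_ge0.
have quad (h : R) : 0 <= theta0 + h -> `|h| * B <= 2^-1 -> 0 <= h * S + 2 * h ^+ 2 * Q.
  move=> /tmin th hB; rewrite -(lerDl (laplace theta0)) (le_trans th)//.
  rewrite /laplace /S /Q !mulr_sumr -!big_split/=; apply: ler_sum => j _.
  rewrite mulrDl expRD [leLHS]mulrA.
  have := @expR_le_quad (h * d j) _.
  have -> : `|h * d j| <= 2^-1.
    by rewrite normrM (le_trans _ hB)// ler_wpM2l.
  move=> /(_ isT) e.
  have := ler_wpM2l (mulr_ge0 (w_ge0 j) (expR_ge0 (theta0 * d j))) e.
  move=> /le_trans; apply; rewrite le_eqVlt; apply/orP; left; apply/eqP; ring.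
have small (eta U : R) : 0 < eta ->
    (forall h : R, 0 < h -> h <= eta -> 0 <= U + 2 * h * Q) -> 0 <= U.
  move=> eta0 hU; rewrite leNgt; apply/negP => U0.
  have q0 : 0 < 4 * (Q + 1) by lra.
  (* If [U < 0], this [h] makes [2 h Q] at most [- U / 2], so [U + 2 h Q] remains negative. *)
  pose h := Num.min eta (- U / (4 * (Q + 1))).
  have h0 : 0 < h by rewrite lt_min eta0 divr_gt0//; lra.
  have hle : h * (4 * (Q + 1)) <= - U by rewrite -ler_pdivlMr// ge_min lexx orbT.
  have := hU h h0; rewrite ge_min lexx => /(_ isT); nra.
have B2 : 0 < 2^-1 / B by rewrite divr_gt0.
split.
  apply: (small (2^-1 / B)) => // h h0 hB.
  have := quad h (addr_ge0 t0 (ltW h0)).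
  rewrite gtr0_norm// -ler_pdivlMr// => /(_ hB).
  have -> : h * S + 2 * h ^+ 2 * Q = h * (S + 2 * h * Q) by ring.
  by rewrite (pmulr_rge0 _ h0).
move=> t00; apply/eqP; rewrite eq_le; apply/andP; split; last first.
  apply: (small (2^-1 / B)) => // h h0 hB.
  have := quad h (addr_ge0 t0 (ltW h0)).
  rewrite gtr0_norm// -ler_pdivlMr// => /(_ hB).
  have -> : h * S + 2 * h ^+ 2 * Q = h * (S + 2 * h * Q) by ring.
  by rewrite (pmulr_rge0 _ h0).
(* For the opposite sign one moves left; the bound [h <= theta0] keeps [theta0 - h] in the
   half-line. *)
rewrite -oppr_ge0; apply: (small (Num.min theta0 (2^-1 / B))) => //.
  by rewrite lt_min t00.
move=> h h0; rewrite le_min => /andP[ht hB].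
have := quad (- h); rewrite normrN gtr0_norm// -ler_pdivlMr// subr_ge0.
move=> /(_ ht hB).
have -> : - h * S + 2 * (- h) ^+ 2 * Q = h * (- S + 2 * h * Q) by ring.
by rewrite (pmulr_rge0 _ h0).
Qed.

Lemma continuous_laplace : continuous laplace.
Proof.
move=> x; rewrite /laplace.
apply: cvg_big => [|j _]; first exact: add_continuous.
apply: cvgMr; apply: (@continuous_comp _ _ _ (fun th : R => th * d j) (@expR R)).
  exact: mulrr_continuous.
exact: continuous_expR.
Qed.

(** A positive displacement makes the transform coercive: beyond [Th] the term [j] alone exceeds
    [laplace 0], so the minimum over [[0, Th]] is global. *)
Lemma laplace_min : (exists j, 0 < w j /\ 0 < d j) ->
  exists2 theta0, 0 <= theta0 &
    forall theta, 0 <= theta -> laplace theta0 <= laplace theta.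
Proof.
move=> [j [wj dj]].
pose Th := laplace 0 / (w j * d j).
have wd : 0 < w j * d j by rewrite mulr_gt0.
have l0 : 0 <= laplace 0.
  by apply: sumr_ge0 => i _; rewrite mulr_ge0 ?expR_ge0.
have Th0 : 0 <= Th by rewrite divr_ge0// ltW.
have [|t0] := @EVT_min R laplace 0 Th Th0.
  by apply: continuous_subspaceT; exact: continuous_laplace.
rewrite in_itv/= => /andP[t00 t0T] tmin; exists t0 => // th th0.
have [thT|thT] := leP th Th; first by apply: tmin; rewrite in_itv/= th0.
apply: (@le_trans _ _ (laplace 0)); first by apply: tmin; rewrite in_itv/= lexx.
apply: (@le_trans _ _ (w j * expR (th * d j))).
  have : Th * (w j * d j) <= th * (w j * d j) by rewrite ler_wpM2r// ltW.
  rewrite /Th mulfVK ?gt_eqF// => /le_trans; apply.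
  rewrite mulrCA ler_wpM2l//; have := expR_ge1Dx (th * d j); lra.
rewrite /laplace (bigD1 j)//= lerDl; apply: sumr_ge0 => i _.
by rewrite mulr_ge0 ?expR_ge0.
Qed.

(* [S] is proportional to the drift of the tilted step; it is nonnegative, so
   its contribution has the right sign as soon as [c] is nonincreasing. *)
Lemma tilted_subsolution (theta0 rho : R) (c c' : R -> R) :
  let S := \sum_j w j * expR (theta0 * d j) * d j in
    0 <= rho -> rho < laplace theta0 ->
    (forall s, 0 <= c s) ->
    (forall s t, `|t| <= 2^-1 -> (1 - 4 * t ^+ 2) * c s + c' s * t <= c (s + t)) ->
    0 <= S -> (S = 0 \/ forall s, c' s <= 0) ->
  exists kappa, exists rho1, [/\ 0 < kappa, rho < rho1 &
    let phi y := expR (- (theta0 * y)) * c (kappa * y) in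
    forall y, rho1 * phi y <= \sum_j w j * phi (y - d j)].
Proof.
move=> S rho0 rhom c0 cT S0 Sc.
set mu := laplace theta0 in rhom *.
have mu0 : 0 < mu by exact: le_lt_trans rhom.
(* Since [k <= 1], [(1 - k^2) mu >= (1 - k) mu = (mu + rho) / 2 > rho]; this is [rho1]. The scale
   [kappa = k / (2 B)] makes every rescaled step at most [k / 2], so the loss [4 t^2] is at most
   [k^2]. *)
pose k := (mu - rho) / (2 * mu).
have k0 : 0 < k by rewrite divr_gt0//; lra.
have kmu : k * (2 * mu) = mu - rho by rewrite /k mulfVK// mulf_neq0 ?gt_eqF.
have k1 : k <= 1 by rewrite ler_pdivrMr//; lra.
have kappa0 : 0 < k / (2 * B) by rewrite divr_gt0// mulr_gt0.
exists (k / (2 * B)), ((1 - k ^+ 2) * mu); split => //.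
  by nra.
set kappa := k / (2 * B) in kappa0 *.
have kB : kappa * B = k / 2 by rewrite /kappa; field; rewrite gt_eqF.
move=> phi y.
have phiE j : w j * phi (y - d j) = expR (- (theta0 * y)) *
    (w j * expR (theta0 * d j) * c (kappa * y + - (kappa * d j))).
  rewrite /phi mulrBr opprB addrC expRD mulrBr.
  by rewrite (addrC (kappa * y)); ring.
under eq_bigr do rewrite phiE.
rewrite -mulr_sumr /phi mulrCA ler_wpM2l ?expR_ge0//.
apply: (@le_trans _ _ (\sum_j w j * expR (theta0 * d j) *
  ((1 - k ^+ 2) * c (kappa * y) - c' (kappa * y) * kappa * d j))).
  have -> : \sum_j w j * expR (theta0 * d j) *
      ((1 - k ^+ 2) * c (kappa * y) - c' (kappa * y) * kappa * d j) =
      (1 - k ^+ 2) * mu * c (kappa * y) - c' (kappa * y) * kappa * S.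
    rewrite (mulrAC _ mu).
    rewrite /S /mu /laplace !mulr_sumr -sumrB; apply: eq_bigr => j _; ring.
  rewrite lerDl oppr_ge0.
  by case: Sc => [->|/(_ (kappa * y)) c'0]; [rewrite mulr0|rewrite !mulr_le0_ge0// ltW].
apply: ler_sum => j _; rewrite ler_wpM2l ?mulr_ge0 ?expR_ge0//.
have kd : `|kappa * d j| <= k / 2.
  by rewrite normrM gtr0_norm// -kB ler_wpM2l// ltW.
apply: le_trans (cT _ _ _); last first.
  by rewrite normrN (le_trans kd)// ler_pdivrMr// mulVf.
rewrite mulrN -mulrA lerB// ler_wpM2r// sqrrN -(real_normK (num_real (kappa * d j))) lerB//.
have : `|kappa * d j| ^+ 2 <= (k / 2) ^+ 2.
  by rewrite ler_pXn2r// nnegrE; lra.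
have -> : (k / 2) ^+ 2 = k ^+ 2 / 4 by field.
lra.
Qed.

End Laplace.

(** * Subsolutions of the linearised recursion *)

Section Subsolution.
Variable R : realType.
Implicit Types (s t : R).

Lemma quartic_bump_ge0 s : 0 <= quartic_bump s. Proof. exact: sqr_ge0. Qed.

Lemma quartic_bump0 : quartic_bump (0 : R) = 1.
Proof. by rewrite /quartic_bump /quartic_bump_base expr0n/= subr0 max_r ?expr1n. Qed.

Lemma quartic_bump_base_eq0 s : 1 <= `|s| -> quartic_bump_base s = 0.
Proof.
move=> s1; rewrite /quartic_bump_base max_l// subr_le0 -real_normK ?num_real//.
exact: exprn_ege1.
Qed.

Lemma quartic_bump_eq0 s : 1 <= `|s| -> quartic_bump s = 0.
Proof. by move=> s1; rewrite /quartic_bump quartic_bump_base_eq0// expr0n. Qed.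

Lemma quartic_bump_le1 s : quartic_bump s <= 1.
Proof.
rewrite /quartic_bump /quartic_bump_base exprn_ile1 ?le_max ?lexx// ge_max ler01/=.
by rewrite gerBl sqr_ge0.
Qed.

(** Flattened to 1 on the negative axis, hence nonincreasing. It serves the case [theta0 = 0], where
    the drift may be strictly positive. *)
Definition half_bump s : R := quartic_bump (Num.max s 0).

(** For [s <= 0] this is the bound for the bump at 0 together with monotonicity; for [s > 0] it
    holds because the bump lies below the half bump. *)
Lemma half_bump_taylor s t : `|t| <= 2^-1 ->
  (1 - 4 * t ^+ 2) * half_bump s
    + - (4 * Num.max s 0 * quartic_bump_base (Num.max s 0)) * t <= half_bump (s + t).
Proof.
move=> t1; have qbumpS x y : 0 <= x -> x <= y -> quartic_bump y <= quartic_bump x.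
  move=> x0 xy; rewrite /quartic_bump.
  have base0 u : 0 <= quartic_bump_base u by rewrite /quartic_bump_base le_max lexx.
  rewrite ler_pXn2r ?nnegrE ?base0//.
  have xy2 : x ^+ 2 <= y ^+ 2 by rewrite ler_pXn2r ?nnegrE ?(le_trans x0 xy).
  by rewrite /quartic_bump_base le_max2// lerB.
have le_half z : quartic_bump z <= half_bump z.
  rewrite /half_bump; have [x0|//] := leP z 0.
  by rewrite quartic_bump0 quartic_bump_le1.
have [s0|s0] := leP s 0.
  rewrite /half_bump (max_r s0) mulr0 mul0r oppr0 mul0r addr0.
  have := quartic_bump_taylor 0 t1; rewrite mulr0 !mul0r subr0 add0r => /le_trans; apply.
  apply: (le_trans (le_half t)); rewrite /half_bump; apply: qbumpS.
    by rewrite le_max lexx orbT.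
  by rewrite ge_max !le_max lexx orbT gerDr s0.
have := quartic_bump_taylor s t1; rewrite /half_bump (max_l (ltW s0)) mulNr.
by move=> /le_trans; apply; exact: le_half.
Qed.

(** At a boundary minimiser only the sign of the drift is known, and the half bump is used; at an
    interior one the drift vanishes and the symmetric bump works. In both cases the vanishing beyond
    [width] makes the initial comparison with a survival probability possible. *)
Lemma subsolution_exists (J : finType) (w d : J -> R) (rho : R) :
    (forall j, 0 <= w j) -> (exists j, 0 < w j /\ 0 < d j) -> 0 <= rho ->
    (forall theta, 0 <= theta -> rho < laplace w d theta) ->
  exists (phi : R -> R) (bound width rho1 : R),
    [/\ forall y, 0 <= phi y <= bound, 0 < phi 0,
        forall y, width < y -> phi y = 0, rho < rho1 &
        forall y, rho1 * phi y <= \sum_j w j * phi (y - d j)].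
Proof.
move=> w0 wd rho0 rho_lt.
have [theta0 t0 tmin] := laplace_min w0 wd.
have [S0 St] := laplace_first_order w0 t0 tmin.
have := rho_lt _ t0 => /tilted_subsolution tilt.
move: t0; rewrite le_eqVlt => /orP[/eqP t0|t0].
- subst theta0.
  have [||||kappa [rho1 [k0 rho1P] /=]] :=
      tilt w0 half_bump (fun s => - (4 * Num.max s 0 * quartic_bump_base (Num.max s 0))) rho0.
  + by move=> s; exact: quartic_bump_ge0.
  + exact: half_bump_taylor.
  + exact: S0.
  + right => s; rewrite oppr_le0 !mulr_ge0 ?le_max ?lexx ?orbT//.
  move=> h; pose phi y := expR (- (0 * y)) * half_bump (kappa * y).
  exists phi, 1, (kappa^-1), rho1.
  split => //.
  + by move=> y; rewrite /phi mul0r oppr0 expR0 mul1r quartic_bump_ge0 quartic_bump_le1.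
  + by rewrite /phi mul0r oppr0 expR0 mul1r mulr0 /half_bump maxxx quartic_bump0.
  + move=> y ky; rewrite /phi /half_bump quartic_bump_eq0 ?mulr0//.
    have : 1 <= kappa * y by rewrite mulrC -ler_pdivrMr// div1r ltW.
    by move=> ky1; rewrite max_l ?(le_trans ler01)// ler_normr ky1.
- have [||||kappa [rho1 [k0 rho1P] /=]] :=
      tilt w0 (@quartic_bump R) (fun s => - (4 * s * quartic_bump_base s)) rho0.
  + exact: quartic_bump_ge0.
  + by move=> s t t1; rewrite mulNr quartic_bump_taylor.
  + exact: S0.
  + by left; exact: St.
  move=> h; pose phi y := expR (- (theta0 * y)) * quartic_bump (kappa * y).
  (* On the support of the bump [y > - 1 / kappa], which bounds the exponential factor. *)
  exists phi, (expR (theta0 / kappa)), (kappa^-1), rho1; split => //.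
  + move=> y; rewrite /phi mulr_ge0 ?expR_ge0 ?quartic_bump_ge0//=.
    have [k1|k1] := leP 1 (`|kappa * y|).
      by rewrite quartic_bump_eq0// mulr0 expR_ge0.
    rewrite (le_trans (ler_wpM2l (expR_ge0 _) (quartic_bump_le1 _)))// mulr1 ler_expR.
    rewrite -mulrN ler_wpM2l ?ltW//.
    move: k1; rewrite normrM gtr0_norm// mulrC -ltr_pdivlMr// div1r ltr_norml.
    by lra.
  + by rewrite /phi !mulr0 oppr0 expR0 mul1r quartic_bump0.
  + move=> y ky; rewrite /phi quartic_bump_eq0 ?mulr0//.
    have : 1 <= kappa * y by rewrite mulrC -ler_pdivrMr// div1r ltW.
    by move=> ky1; rewrite ler_normr ky1.
Qed.

End Subsolution.

(** * The recursion for extinction probabilities and its linearisation *)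

Section Recursion.
Variables (R : realType) (I : finType) (K : nat).
Variables (p : I -> R) (D : I -> 'I_K -> \bar R).
Hypothesis p_ge0 : forall t, 0 <= p t.
Hypothesis p_sum1 : \sum_t p t = 1.

(** The quantity [1 - q_n(y)] when a family has type [t] with probability [p t]; the value -oo marks
    a missing child. *)
Fixpoint extinct (n : nat) (y : R) : R :=
  if n is n'.+1 then
    \sum_t p t * \prod_(k < K | D t k != -oo%E) extinct n' (y - fine (D t k))
  else if y <= 0 then 0 else 1.

Lemma extinct_bounds n y : 0 <= extinct n y <= 1.
Proof.
elim: n y => [|n ih] y /=; first by case: ifP; rewrite ?ler01 ?lexx.
apply/andP; split.
  apply: sumr_ge0 => t _; rewrite mulr_ge0// prodr_ge0// => k _.
  by case/andP: (ih (y - fine (D t k))).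
rewrite -[leRHS]p_sum1; apply: ler_sum => t _; rewrite ler_piMr//.
apply: numdomain.Num.Theory.prodr_ile1 => k _; exact: ih.
Qed.

Lemma extinct_homo n : {homo extinct n : y y' / y <= y'}.
Proof.
elim: n => [|n ih] y y' yy' /=.
  case: (leP y 0) => y0; first by case: ifP => _; rewrite ?ler01.
  by rewrite [y' <= 0]leNgt (lt_le_trans y0 yy').
apply: ler_sum => t _; rewrite ler_wpM2l//; apply: ler_prod => k _.
by case/andP: (extinct_bounds n (y - fine (D t k))) => -> _ /=; rewrite ih// lerB.
Qed.

Definition survive n y := 1 - extinct n y.

Lemma surviveS n y : survive n.+1 y =
  \sum_t p t * (1 - \prod_(k < K | D t k != -oo%E) extinct n (y - fine (D t k))).
Proof.
rewrite /survive/= -[X in X - _]p_sum1 -sumrB.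
by apply: eq_bigr => t _; rewrite mulrBr mulr1.
Qed.

(** A Bonferroni-type bound with a crude quadratic term, by induction on the number of factors. *)
Lemma prod1B_le (S : seq 'I_K) (P : pred 'I_K) (a : 'I_K -> R) :
  (forall k, 0 <= a k <= 1) ->
  \prod_(k <- S | P k) (1 - a k) <=
    1 - \sum_(k <- S | P k) a k + (\sum_(k <- S | P k) a k) ^+ 2.
Proof.
move=> a01; elim: S => [|k S ih]; first by rewrite !big_nil; lra.
rewrite !big_cons; case: ifP => // _.
set s := (\sum_(_ <- _ | _) _) in ih *.
have s0 : 0 <= s by apply: sumr_ge0 => i _; case/andP: (a01 i).
have /andP[a0 a1] := a01 k.
have : (1 - a k) * (\prod_(j <- S | P j) (1 - a j)) <= (1 - a k) * (1 - s + s ^+ 2).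
  by rewrite ler_wpM2l// subr_ge0.
move=> /le_trans; apply; rewrite !expr2; nra.
Qed.

(* By [prod1B_le], while the survival probabilities stay below [delta] the
   recursion dominates its linearisation up to the factor [1 - K * delta]. *)
Lemma survive_ge (x rho rho1 bound : R) (phi : R -> R) (n0 : nat) (c0 : R) :
    0 < rho -> rho <= 1 -> rho < rho1 -> (forall y, 0 <= phi y <= bound) ->
    (forall y, rho1 * phi y <=
      \sum_t p t * \sum_(k < K | D t k != -oo%E) phi (y - (fine (D t k) - x))) ->
    0 < c0 -> (forall y, c0 * phi y <= survive n0 (n0%:R * x + y)) ->
  exists2 c, 0 < c & forall n y,
    c * rho ^+ n * phi y <= survive (n0 + n) ((n0 + n)%:R * x + y).
Proof.
move=> rho_gt0 rho_le1 rho1P phib sub c0_gt0 init.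
have bound0 : 0 <= bound.
  by have /andP[a b] := phib 0; exact: le_trans b.
have rho10 : 0 < rho1 by exact: lt_trans rho1P.
(* Chosen so that [rho1 * (1 - K * delta) >= rho]: the gap between [rho1] and [rho] pays for the
   linearisation. *)
pose delta := (rho1 - rho) / (rho1 * (K.+1%:R)).
have K0 : 0 < K.+1%:R :> R by rewrite ltr0n.
have KK : K%:R + 1 = K.+1%:R :> R by rewrite -natr1.
have K0' : 0 <= K%:R :> R by [].
have delta0 : 0 < delta by rewrite divr_gt0 ?mulr_gt0// subr_gt0.
have deltaE : delta * rho1 * K.+1%:R = rho1 - rho.
  by rewrite /delta -mulrA mulfVK// mulf_neq0// gt_eqF.
have Kd : rho <= rho1 * (1 - K%:R * delta).
  have -> : rho1 * (1 - K%:R * delta) = rho1 - (delta * rho1 * (K%:R + 1)) + delta * rho1 by ring.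
  rewrite KK deltaE; have := mulr_gt0 delta0 rho10; lra.
have Kd1 : K%:R * delta <= 1.
  rewrite leNgt; apply/negP => h; nra.
have d1 : delta <= 1.
  rewrite /delta ler_pdivrMr ?mulr_gt0// mul1r -KK; nra.
(* The second bound keeps [c * phi] below [delta]; as [rho <= 1], all iterates [c * rho ^+ n * phi]
   then stay where the linearisation is valid. *)
pose c := Num.min c0 (delta / (bound + 1)).
have b1 : 0 < bound + 1 by lra.
have c_gt0 : 0 < c by rewrite lt_min c0_gt0 divr_gt0.
have cphi y : 0 <= c * phi y <= delta.
  have /andP[p0 pb] := phib y; rewrite mulr_ge0 ?(ltW c_gt0)//=.
  have : c <= delta / (bound + 1) by rewrite ge_min lexx orbT.
  rewrite ler_pdivlMr// => cb; nra.
exists c => // n; elim: n => [|n ih] y.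
  rewrite addn0 expr0 mulr1 (le_trans _ (init y))// ler_wpM2r//.
    by case/andP: (phib y).
  by rewrite ge_min lexx.
rewrite addnS surviveS.
pose a t (k : 'I_K) := c * rho ^+ n * phi (y - (fine (D t k) - x)).
have r01 : 0 <= rho ^+ n <= 1.
  by rewrite exprn_ge0 ?(ltW rho_gt0)//= exprn_ile1 ?(ltW rho_gt0).
have ad t k : 0 <= a t k <= delta.
  rewrite /a mulrAC; have /andP[u v] := cphi (y - (fine (D t k) - x)).
  case/andP: r01 => r0 r1; rewrite mulr_ge0//= (le_trans _ v)//.
  by rewrite ler_piMr.
have a1 t k : 0 <= a t k <= 1 by have /andP[-> /le_trans->] := ad t k.
apply: (@le_trans _ _ (\sum_t p t * ((1 - K%:R * delta) *
   \sum_(k < K | D t k != -oo%E) a t k))); last first.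
  apply: ler_sum => t _; rewrite ler_wpM2l//.
  rewrite lerBrDr -lerBrDl.
  apply: (@le_trans _ _ (\prod_(k < K | D t k != -oo%E) (1 - a t k))).
    apply: ler_prod => k _; have /andP[-> _ /=] := extinct_bounds (n0 + n)
        ((n0 + n).+1%:R * x + y - fine (D t k)).
    have := ih (y - (fine (D t k) - x)); rewrite /survive -/(a t k).
    have -> : (n0 + n)%:R * x + (y - (fine (D t k) - x)) =
       (n0 + n).+1%:R * x + y - fine (D t k) by rewrite -natr1; ring.
    lra.
  apply: (le_trans (prod1B_le _ _ (a1 t))).
  set s := \sum_(_ < _ | _) _.
  have s0 : 0 <= s by apply: sumr_ge0 => i _; case/andP: (a1 t i).
  have sK : s <= K%:R * delta.
    rewrite /s big_mkcond/=.
    apply: (@le_trans _ _ (\sum_(k < K) delta)).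
      by apply: ler_sum => k _; case: ifP => _; [case/andP: (ad t k)|exact: ltW].
    by rewrite sumr_const card_ord mulr_natl.
  rewrite expr2; nra.
rewrite exprSr.
have /andP[phi0 _] := phib y; have /andP[r0 r1] := r01.
apply: (@le_trans _ _ ((1 - K%:R * delta) * (c * rho ^+ n) * (rho1 * phi y))).
  have : 0 <= c * rho ^+ n * phi y by rewrite !mulr_ge0// ltW.
  move=> h; have := ler_wpM2l h Kd; lra.
apply: (@le_trans _ _ ((1 - K%:R * delta) * (c * rho ^+ n) *
   \sum_t p t * \sum_(k < K | D t k != -oo%E) phi (y - (fine (D t k) - x)))).
  apply: ler_wpM2l (sub y).
  by rewrite !mulr_ge0 ?subr_ge0// ltW.
rewrite mulr_sumr; apply: ler_sum => t _.
rewrite le_eqVlt; apply/orP; left; apply/eqP.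
rewrite -/(a t _) [in RHS]/a -mulr_sumr; ring.
Qed.

(** A single line of descent suffices: [n] successive families of type [t], following child [k] each
    time. *)
Lemma survive_line (t : I) (k : 'I_K) (n : nat) : D t k != -oo%E ->
  p t ^+ n <= survive n (n%:R * fine (D t k)).
Proof.
move=> Dtk; elim: n => [|n ih]; first by rewrite /survive/= mul0r lexx subr0.
rewrite surviveS (bigD1 t)//=.
apply: ler_wpDr.
  apply: sumr_ge0 => i _; rewrite mulr_ge0// subr_ge0.
  by apply: numdomain.Num.Theory.prodr_ile1 => j _; exact: extinct_bounds.
rewrite exprS ler_wpM2l// (le_trans ih)// lerB//.
rewrite (bigD1 k)//=.
have -> : n.+1%:R * fine (D t k) - fine (D t k) = n%:R * fine (D t k).
  by rewrite -natr1; ring.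
rewrite ler_piMr//; first by case/andP: (extinct_bounds n (n%:R * fine (D t k))).
by apply: numdomain.Num.Theory.prodr_ile1 => j _; exact: extinct_bounds.
Qed.

End Recursion.

(** * Survival of the walk with finitely many types *)

Section FiniteTypes.
Variables (R : realType) (d : measure_display) (T : measurableType d).
Variables (P : probability T R) (z : vertex -> T -> nat -> \bar R).
Hypothesis z_measurable : forall u k, measurable_fun setT (fun w => z u w k).
Hypothesis z_indep : mutually_independent P (eval_sigma setT) z.
Hypothesis z_ident : forall u v, same_law P P (eval_sigma setT) (z u) (z v).

Variables (K : nat) (I : finType) (tau : (nat -> \bar R) -> I).
Variable D : I -> 'I_K -> \bar R.
Hypothesis tau_measurable : forall t, eval_sigma setT (tau @^-1` [set t]).

Lemma z_preimage_measurable u (B : set (nat -> \bar R)) :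
  eval_sigma setT B -> measurable (z u @^-1` B).
Proof.
move=> sB.
pose G : set (set (nat -> \bar R)) := [set B | measurable (z u @^-1` B)].
suff : eval_sigma setT `<=` G by apply.
apply: smallest_sub.
  split => /=.
  - by rewrite /G/= preimage_set0.
  - move=> A; rewrite /G/= => mA.
    by rewrite setTD preimage_setC; exact: measurableC.
  - move=> F; rewrite /G/= => mF; rewrite preimage_bigcup.
    exact: bigcupT_measurable.
move=> _ [k _ [A mA <-]]; rewrite /G/= setTI.
by have := z_measurable u k measurableT mA; rewrite setTI.
Qed.

Definition type_prob (t : I) : R := fine (P (z [::] @^-1` (tau @^-1` [set t]))).

Lemma type_probE u t : P (z u @^-1` (tau @^-1` [set t])) = (type_prob t)%:E.
Proof.
rewrite (z_ident u [::] (tau_measurable t)) fineK// fin_num_measure//.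
exact: z_preimage_measurable (tau_measurable t).
Qed.

Lemma partition_types (E : set T) u : measurable E ->
  P E = (\sum_t P (E `&` z u @^-1` (tau @^-1` [set t])))%E.
Proof.
move=> mE.
have {1}-> : E = \bigcup_(t in [set: I]) (E `&` z u @^-1` (tau @^-1` [set t])).
  rewrite -setI_bigcupr; apply/seteqP; split=> [w Ew|w []//].
  by split=> //; exists (tau (z u w)).
rewrite measure_fin_bigcup//.
- rewrite (fsbig_seq _ _ (index_enum_uniq I)); apply: eq_fsbigl.
  by apply/seteqP; split => // t _ /=; exact: mem_index_enum.
- exact: finite_finset.
- apply/trivIsetP => t t' _ _ /eqP tt'; apply/seteqP; split => // w.
  by move=> [[_ e] [_ e']]; apply: tt'; rewrite -e -e'.
- by move=> t _; apply: measurableI => //; exact: z_preimage_measurable (tau_measurable t).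
Qed.

Lemma type_prob_ge0 t : 0 <= type_prob t.
Proof. exact: fine_ge0. Qed.

Lemma type_prob_sum1 : \sum_t type_prob t = 1.
Proof.
apply: EFin_inj; rewrite -(@probability_setT _ _ _ P) (partition_types [::] measurableT).
rewrite -sumEFin; apply: eq_bigr => t _.
by rewrite setTI -(type_probE [::]).
Qed.

Lemma integral_type (h : I -> R) u : (forall t, 0 <= h t) ->
  (\int[P]_w (h (tau (z u w)))%:E = (\sum_t type_prob t * h t)%:E)%E.
Proof.
move=> h0.
pose A t := z u @^-1` (tau @^-1` [set t]).
have mA t : measurable (A t) by exact: z_preimage_measurable (tau_measurable t).
transitivity (\int[P]_w (\sum_t (h t)%:E * (\1_(A t) w)%:E))%E.
  apply: eq_integral => w _; rewrite (bigD1 (tau (z u w)))//= big1 ?adde0.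
    by rewrite indicE mem_set ?mule1.
  by move=> t tw; rewrite indicE memNset ?mule0// => /= wt; rewrite -wt eqxx in tw.
rewrite ge0_integral_sum//.
- rewrite -sumEFin; apply: eq_bigr => t _; rewrite ge0_integralZl_EFin//.
    have PA : P (A t) = (type_prob t)%:E := type_probE u t.
    rewrite (integral_indic P measurableT (mA t)) setIT mulrC EFinM.
    by congr (_ * _)%E; exact: PA.
  by apply/measurable_EFinP; exact: measurable_indic.
- move=> t; apply/measurable_EFinP; apply: measurable_funM; first exact: measurable_cst.
  exact: measurable_indic.
- by move=> t w _; rewrite mule_ge0 ?lee_fin.
Qed.

(** Written from the top of the tree so as to match [extinct]. Displacements are the rounded ones;
    [survivor_M] returns to the actual walk. *)
Fixpoint survivor (n : nat) (v : vertex) (y : R) (w : T) : Prop :=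
  if n is n'.+1 then
    exists k : 'I_K, let x := D (tau (z v w)) k in
      x != -oo%E /\ survivor n' (rcons v k) (y - fine x) w
  else y <= 0.

(* An item [(v, n, y)] asserts that no descendant of [v], [n] generations
   below it, has moved by at least [y]. *)
Definition item : Type := (vertex * nat * R)%type.

(** A state in the exploration of the tree: [s] is the explored part and [L] the frontier.
    Independence concerns finite sets of distinct vertices, and the exploration reduces extinction
    to such sets by revealing one vertex at a time. *)
Definition frontier_event (s : seq vertex) (t : vertex -> I) (L : seq item) :
    set T :=
  [set w | (forall u, u \in s -> tau (z u w) = t u) /\
           (forall x, x \in L -> ~ survivor x.1.2 x.1.1 x.2 w)].

Definition incomparable (x y : item) :=
  ~~ prefix x.1.1 y.1.1 && ~~ prefix y.1.1 x.1.1.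

(** The subtrees of the items are pairwise disjoint and contain no explored vertex, so that no
    vertex is ever revealed twice. *)
Definition frontier_wf (s : seq vertex) (L : seq item) :=
  [&& uniq s, pairwise incomparable L &
      all (fun x : item => all (fun u => ~~ prefix x.1.1 u) s) L].

Definition children (v : vertex) (n : nat) (y : R) (t : I) : seq item :=
  [seq (rcons v (nat_of_ord k), n, y - fine (D t k)) | k <- enum 'I_K & D t k != -oo%E].

Lemma prefix_rconsl (v u : vertex) k : prefix (rcons v k) u -> prefix v u.
Proof. exact: prefix_trans (prefix_rcons v k). Qed.

Lemma prefix_rconsr (v u : vertex) k :
  prefix u (rcons v k) -> ~~ prefix v u -> prefix u v.
Proof.
move=> /prefixP[r]; case/lastP: r => [|r j].
  by rewrite cats0 => <-; rewrite prefix_rcons.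
by rewrite -rcons_cat => /rcons_inj[-> _] _; rewrite prefix_prefix.
Qed.

Lemma frontier_wf_step s v n y t L : frontier_wf s ((v, n.+1, y) :: L) ->
  frontier_wf (v :: s) (children v n y t ++ L).
Proof.
rewrite /frontier_wf/= => /and3P[us /andP[vL pL] /andP[vs Ls]].
apply/and3P; split.
- rewrite us andbT; apply/negP => /(allP vs).
  by rewrite prefix_refl.
- rewrite pairwise_cat pL andbT; apply/andP; split.
    apply/allrelP => _ x /mapP[k _ ->] xL.
    have /andP[/= h1 h2] := allP vL x xL.
    rewrite /incomparable/=; apply/andP; split.
      by apply: contra h1 => /prefix_rconsl.
    by apply/negP => /prefix_rconsr /(_ h1); rewrite (negPf h2).
  rewrite /children pairwise_map pairwise_filter//.
  have := enum_uniq 'I_K; rewrite uniq_pairwise.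
  apply: sub_pairwise => k k' /= kk'.
  rewrite /incomparable/= !prefixE !size_rcons.
  rewrite !take_oversize ?size_rcons// !eqseq_rcons eqxx/=.
  by rewrite (eq_sym (k' : nat)) andbb.
- rewrite all_cat; apply/andP; split; last first.
    apply/allP => x xL /=; rewrite (allP Ls x xL) andbT.
    by have /andP[] := allP vL x xL.
  apply/allP => _ /mapP[k _ ->] /=; apply/andP; split.
    by apply/negP => /size_prefix; rewrite size_rcons ltnn.
  apply/allP => u /(allP vs); apply: contra; exact: prefix_rconsl.
Qed.

Lemma frontier_event_step s t v n y L : v \notin s ->
  frontier_event s t ((v, n.+1, y) :: L) =
  \bigcup_(i in [set: I]) frontier_event (v :: s)
    (fun u => if u == v then i else t u) (children v n y i ++ L).
Proof.
move=> vs; apply/seteqP; split => [w [ws wL]|w [i _ [ws wL]]].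
- exists (tau (z v w)) => //; split.
    move=> u; rewrite inE; case: eqVneq => [->//|_/=]; exact: ws.
  move=> x; rewrite mem_cat => /orP[/mapP[k]|xL]; last first.
    by apply: wL; rewrite inE xL orbT.
  rewrite mem_filter => /andP[Dk _] -> /= sk.
  by apply: (wL (v, n.+1, y)); rewrite ?mem_head//=; exists k.
- have tv : tau (z v w) = i by have := ws v; rewrite mem_head eqxx; apply.
  split.
    move=> u us; rewrite ws ?inE ?us ?orbT//.
    by case: eqVneq us vs => // -> ->.
  move=> x; rewrite inE => /orP[/eqP->/= [k]|xL]; last first.
    by apply: wL; rewrite mem_cat xL orbT.
  rewrite tv => -[Dk]; apply: (wL (rcons v k, n, y - fine (D i k))).
  rewrite mem_cat; apply/orP; left; apply/mapP; exists k => //.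
  by rewrite mem_filter Dk mem_enum.
Qed.

(** Revealing the first vertex of the frontier and summing over its type reproduces one step of
    [extinct]. When the frontier is empty, only the mutual independence of the explored vertices is
    left. *)
Lemma frontier_prob s t L : frontier_wf s L ->
  measurable (frontier_event s t L) /\
  P (frontier_event s t L) = (\prod_(u <- s) type_prob (t u) *
    \prod_(x <- L) extinct type_prob D x.1.2 x.2)%:E.
Proof.
(* This weight decreases strictly at each revelation, since an item of height [n + 1] is replaced by
   at most [K] items of height [n] and [K (K + 1)^n < (K + 1)^(n + 1)]. *)
pose weight (L : seq item) := (\sum_(x <- L) K.+1 ^ x.1.2)%N.
move: (leqnn (weight L)); move: {2}(weight L) => N.
elim: N s t L => [|N ih] s t [|[[v [|n]] y] L]; rewrite /weight ?big_cons/=.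
- move=> _ /and3P[us _ _].
  have -> : frontier_event s t [::] =
      \bigcap_(u in [set` s]) (z u @^-1` (tau @^-1` [set t u])).
    by apply/seteqP; split => [w [h _] u us'|w h]; [exact: h|split].
  split.
    apply: fin_bigcap_measurable => // u _.
    exact: z_preimage_measurable (tau_measurable _).
  rewrite (z_indep us (fun u => tau_measurable (t u))) big_nil mulr1 -prodEFin.
  by apply: eq_bigr => u _; exact: type_probE.
- by rewrite leqn0 addn_eq0 expn0.
- by rewrite leqn0 addn_eq0 expn_eq0.
- by move=> _; apply: ih; rewrite /weight big_nil.
- rewrite expn0 add1n ltnS => LN wf.
  have wf' : frontier_wf s L by case/and3P: wf => us /andP[_ pL] /andP[_ Ls]; apply/and3P.
  have [mE PE] := ih s t L LN wf'.
  case: (leP y 0) => y0.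
    have -> : frontier_event s t ((v, 0%N, y) :: L) = set0.
      by apply/seteqP; split => // w [_ /(_ _ (mem_head _ _))].
    by rewrite measure0 mul0r mulr0.
  have -> : frontier_event s t ((v, 0%N, y) :: L) = frontier_event s t L.
    apply/seteqP; split => w [ws wL]; split => //.
      by move=> x xL; apply: wL; rewrite inE xL orbT.
    move=> x; rewrite inE => /orP[/eqP->/=|]; last exact: wL.
    by apply/negP; rewrite -ltNge.
  by rewrite mul1r.
- move=> LN wf; have vs : v \notin s.
    case/and3P: wf => _ _ /andP[/allP h _]; apply/negP => /h.
    by rewrite prefix_refl.
  rewrite (frontier_event_step _ _ _ _ vs).
  set t' := fun i u => if u == v then i else t u.
  have ihi i : measurable (frontier_event (v :: s) (t' i) (children v n y i ++ L)) /\
      P (frontier_event (v :: s) (t' i) (children v n y i ++ L)) =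
      (type_prob i * \prod_(u <- s) type_prob (t u) *
       (\prod_(k < K | D i k != -oo%E) extinct type_prob D n (y - fine (D i k)) *
    \prod_(x <- L) extinct type_prob D x.1.2 x.2))%:E.
    have [|mE ->] := ih (v :: s) (t' i) (children v n y i ++ L) _ (frontier_wf_step i wf).
      rewrite -ltnS (leq_trans _ LN)// /weight big_cat/= ltn_add2r.
      rewrite big_map big_filter expnS mulSn.
      apply: (@leq_add 1).
        by rewrite expn_gt0.
      rewrite big_mkcond/= big_enum/=.
      apply: (@leq_trans (\sum_(k < K) K.+1 ^ n)).
        by apply: leq_sum => k _; case: ifP.
      by rewrite sum_nat_const card_ord.
    split => //; congr EFin; rewrite big_cons {1}/t' eqxx; congr (_ * _ * _).
      apply: eq_big_seq => u us; rewrite /t'; case: eqVneq => // uv.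
      by move: vs; rewrite -uv us.
    by rewrite big_cat big_map big_filter big_enum_cond.
  split.
    by apply: fin_bigcup_measurable => [|i _]; [exact: finite_finset|case: (ihi i)].
  rewrite measure_fin_bigcup; last 3 first.
  - exact: finite_finset.
  - apply/trivIsetP => i j _ _ /eqP ij; apply/seteqP; split => // w.
    move=> [[/(_ v (mem_head _ _)) ei _] [/(_ v (mem_head _ _)) ej _]].
    by apply: ij; move: ei ej; rewrite eqxx => -> .
  - by move=> i _; case: (ihi i).
  transitivity (\sum_i P (frontier_event (v :: s) (t' i) (children v n y i ++ L)))%E.
    rewrite (fsbig_seq _ _ (index_enum_uniq I)); apply: eq_fsbigl.
    by apply/seteqP; split => // i _ /=; exact: mem_index_enum.
  rewrite (eq_bigr _ (fun i _ => (ihi i).2)).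
  rewrite sumEFin; congr EFin.
  rewrite mulr_suml mulr_sumr; apply: eq_bigr => i _; ring.
Qed.

Lemma survivor_prob n y : measurable [set w | survivor n [::] y w] /\
  P [set w | survivor n [::] y w] = (survive type_prob D n y)%:E.
Proof.
have [|mE PE] := @frontier_prob [::] (fun _ => tau (fun _ => 0%E)) [:: ([::], n, y)].
  by [].
have E : [set w | survivor n [::] y w] =
    ~` frontier_event [::] (fun _ => tau (fun _ => 0%E)) [:: ([::], n, y)].
  apply/seteqP; split => w /= h.
    by move=> [_ /(_ _ (mem_head _ _))].
  apply: contra_notP h => h; split => // x; rewrite inE => /eqP -> //.
rewrite E; split; first exact: measurableC.
rewrite probability_setC// PE !big_seq1 big_nil mul1r.
by rewrite /survive EFinB.
Qed.

Hypothesis D_le : forall (f : nat -> \bar R) (k : 'I_K), (D (tau f) k <= f k)%E.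
Hypothesis z_lt_pinfty : forall u w k, (z u w k < +oo)%E.

(** Rounding only lowers displacements, so the path followed by a survivor is at least as high in
    the actual walk. *)
Lemma survivor_path n v y w : survivor n v y w -> exists u : vertex,
  size u = n /\ (y%:E <= \sum_(i < n) z (v ++ take i u) w (nth 0%N u i))%E.
Proof.
elim: n v y => [|n ih] v y /=.
  by move=> y0; exists [::]; rewrite big_ord0 lee_fin.
move=> [k [Dk /ih[u [un yu]]]]; exists (nat_of_ord k :: u); split=> /=.
  by rewrite un.
rewrite big_ord_recl/= cats0.
have [r Dr] : exists r : R, D (tau (z v w)) k = r%:E.
  have := le_lt_trans (D_le (z v w) k) (z_lt_pinfty v w k).
  by case: (D _ _) Dk => [r _ _||]//; exists r.
rewrite Dr/= EFinB leeBlDr// in yu.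
rewrite addeC (le_trans yu)// leeD//; last by rewrite -Dr D_le.
by apply: lee_sum => i _; rewrite -cats1 -catA.
Qed.

Lemma survivor_M n y w : survivor n [::] y w -> (y%:E <= M z n w)%E.
Proof.
move=> /survivor_path[u [un yu]]; rewrite /M.
have Vu : (y%:E <= V z w u)%E by rewrite /V un.
apply: (le_trans Vu); apply: ereal_sup_ubound; exists u => //.
split => //=; rewrite /mkset; apply/negP => /eqP Vu0.
by move: Vu; rewrite Vu0.
Qed.

End FiniteTypes.

(** * Exponential moments and the upper tail bound *)

Import HBSimple HBNNSimple.

(** * Integrals of products of independent factors *)

Section IntegralIndependence.
Variables (R : realType) (d : measure_display) (T : measurableType d).
Variables (P : probability T R) (X : T -> \bar R).
Hypothesis mX : measurable_fun setT X.

Local Lemma integral_nnsfun_indep (h : {nnsfun \bar R >-> R}) (Y : T -> R) (c : R) :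
    measurable_fun setT Y -> (forall w, 0 <= Y w) ->
    (forall A, measurable A ->
      \int[P]_w (\1_(X @^-1` A) w * Y w)%:E = P (X @^-1` A) * c%:E)%E ->
  (\int[P]_w (h (X w) * Y w)%:E =
   (\sum_(y \in range h) (y%:E * P (X @^-1` (h @^-1` [set y])))) * c%:E)%E.
Proof.
move=> mY Y0 XY.
have mA y : measurable (X @^-1` (h @^-1` [set y])).
  by rewrite -[X in measurable X]setTI; apply: mX => //; exact: measurable_sfunP.
transitivity (\int[P]_w (\sum_(y \in range h)
    (y%:E * (\1_(X @^-1` (h @^-1` [set y])) w * Y w)%:E)))%E.
  apply: eq_integral => w _; rewrite (fimfunE h (X w)).
  rewrite fsbig_finite//= mulr_suml -sumEFin fsbig_finite//=.
  by apply: eq_bigr => y _; rewrite -EFinM mulrA.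
have pos y w : (0 <= y%:E * (\1_(X @^-1` (h @^-1` [set y])) w * Y w)%:E)%E.
  rewrite EFinM muleA mule_ge0 ?lee_fin//.
  by have := nnfun_muleindic_ge0 h y (X w).
rewrite ge0_integral_fsum//; last first.
  move=> y; apply/measurable_EFinP; apply: measurable_funM => //.
  by apply: measurable_funM => //; exact: measurable_indic.
rewrite ge0_mule_fsuml; last first.
  move=> y; have [y0|y0] := leP 0 y; first by rewrite mule_ge0.
  have -> : h @^-1` [set y] = set0.
    apply/seteqP; split => // r /= hr; move: y0; rewrite -hr ltNge.
    by rewrite (@fun_ge0 _ _ h r).
  by rewrite preimage_set0 measure0 mule0.
apply: eq_fsbigr => y; rewrite inE => -[r _ hr].
have y0 : 0 <= y by rewrite -hr fun_ge0.
rewrite ge0_integralZl_EFin//; last 2 first.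
- by move=> w _; rewrite lee_fin mulr_ge0.
- by apply/measurable_EFinP; apply: measurable_funM => //; exact: measurable_indic.
rewrite XY ?muleA//; exact: measurable_sfunP.
Qed.

(** The last hypothesis is independence of [X] and [Y] tested on indicators, with [c] the mean of
    [Y]. It passes to simple functions by linearity, then to [g] by monotone convergence. *)
Lemma integral_indep (g : \bar R -> R) (Y : T -> R) (c : R) :
    measurable_fun setT g -> (forall r, 0 <= g r) ->
    measurable_fun setT Y -> (forall w, 0 <= Y w) ->
    (forall A, measurable A ->
      \int[P]_w (\1_(X @^-1` A) w * Y w)%:E = P (X @^-1` A) * c%:E)%E ->
  (\int[P]_w (g (X w) * Y w)%:E = (\int[P]_w (g (X w))%:E) * c%:E)%E.
Proof.
move=> mg g0 mY Y0 XY.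
have mg' : measurable_fun setT (EFin \o g) by exact/measurable_EFinP.
pose h := nnsfun_approx measurableT mg'.
have hcvg r : (h n r)%:E @[n --> \oo] --> (g r)%:E.
  by apply: (cvg_nnsfun_approx measurableT mg') => // x _; rewrite lee_fin.
have hnd r : {homo (fun n => h n r) : n m / (n <= m)%N >-> n <= m}.
  by move=> n m nm; exact/lefP/(nd_nnsfun_approx measurableT mg').
have lim (Y' : T -> R) : measurable_fun setT Y' -> (forall w, 0 <= Y' w) ->
    (\int[P]_w (h n (X w) * Y' w)%:E)%E @[n --> \oo] -->
    (\int[P]_w (g (X w) * Y' w)%:E)%E.
  move=> mY' Y'0.
  have -> : (\int[P]_w (g (X w) * Y' w)%:E =
      \int[P]_w limn (fun n => (h n (X w) * Y' w)%:E))%E.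
    apply: eq_integral => w _; apply/esym/cvg_lim => //.
    have : (fun n => (h n (X w))%:E * (Y' w)%:E)%E @ \oo --> ((g (X w))%:E * (Y' w)%:E)%E.
      by apply: cvgeZr => //; exact: hcvg.
    by [].
  apply: cvg_monotone_convergence => //.
  - move=> n; apply/measurable_EFinP; apply: measurable_funM => //.
    exact: measurableT_comp.
  - by move=> n w _; rewrite lee_fin mulr_ge0.
  - by move=> w _ n m nm; rewrite lee_fin ler_wpM2r// hnd.
(* The case [Y = 1] identifies the limit of the sums over the values of [h n] as the integral of
   [g (X w)]. *)
have m1 : measurable_fun setT (cst (1 : R) : T -> R) by exact: measurable_cst.
have P1 A : measurable A -> (\int[P]_w (\1_(X @^-1` A) w * cst 1 w)%:E =
    P (X @^-1` A) * 1%:E)%E.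
  move=> mA; under eq_integral do rewrite mulr1.
  have mXA : measurable (X @^-1` A) by rewrite -[_ @^-1` _]setTI; exact: mX.
  by rewrite integral_indic// setIT mule1.
have H := lim _ mY Y0; have H1 := lim _ m1 (fun _ => ler01).
have -> : (\int[P]_w (g (X w))%:E = \int[P]_w (g (X w) * cst 1 w)%:E)%E.
  by under [RHS]eq_integral do rewrite mulr1.
have E n := integral_nnsfun_indep (h n) mY Y0 XY.
have E1 n := integral_nnsfun_indep (h n) m1 (fun _ => ler01) P1.
apply: (cvg_unique (@ereal_hausdorff R) H).
rewrite (funext E); apply: cvgeZr => //.
by move: H1; rewrite (funext E1); under eq_fun do rewrite mule1.
Qed.

End IntegralIndependence.

(** * First moment of multiplicative sums over a generation *)

Section FirstMoment.
Variables (R : realType) (d : measure_display) (T : measurableType d).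
Variables (P : probability T R) (z : vertex -> T -> nat -> \bar R).
Hypothesis z_measurable : forall u k, measurable_fun setT (fun w => z u w k).
Hypothesis z_indep : mutually_independent P (eval_sigma setT) z.
Hypothesis z_ident : forall u v, same_law P P (eval_sigma setT) (z u) (z v).

Lemma eval_sigma_coord k (A : set (\bar R)) : measurable A ->
  eval_sigma setT [set f : nat -> \bar R | A (f k)].
Proof.
move=> mA; apply: sub_sigma_algebra; exists k => //; exists A => //.
by rewrite setTI.
Qed.

Lemma integral_coord (g : \bar R -> \bar R) u k :
    measurable_fun setT g -> (forall r, (0 <= g r)%E) ->
  (\int[P]_w g (z u w k) = \int[P]_w g (z [::] w k))%E.
Proof.
move=> mg g0.
rewrite -[LHS](@ge0_integral_pushforward _ _ _ _ _ _ (z_measurable u k) P setT g)//.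
rewrite -[RHS](@ge0_integral_pushforward _ _ _ _ _ _ (z_measurable [::] k) P setT g)//.
apply: eq_measure_integral => A mA _.
exact: (z_ident u [::] (eval_sigma_coord k mA)).
Qed.

Variables (g : \bar R -> R) (alpha : nat -> R).
Hypotheses (mg : measurable_fun setT g) (g0 : forall r, 0 <= g r).
Hypothesis alphaE : forall k, (\int[P]_w (g (z [::] w k))%:E = (alpha k)%:E)%E.

Let mgz u k : measurable_fun setT (fun w => g (z u w k)).
Proof. exact: measurableT_comp. Qed.

Lemma alpha_ge0 k : 0 <= alpha k.
Proof. by rewrite -lee_fin -alphaE integral_ge0// => w _; rewrite lee_fin. Qed.

(** Mixing function factors with events makes the induction close: to remove a factor by
    [integral_indep], it is tested on indicators, which moves its vertex from [s1] to [s2]. *)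
Lemma path_integral (s1 : seq (vertex * nat)) (s2 : seq vertex)
    (B : vertex -> set (nat -> \bar R)) :
    uniq (map fst s1 ++ s2) -> (forall u, eval_sigma setT (B u)) ->
  (\int[P]_w ((\prod_(x <- s1) g (z x.1 w x.2)) *
      \1_(\bigcap_(u in [set` s2]) (z u @^-1` B u)) w)%:E =
   (\prod_(x <- s1) alpha x.2 * \prod_(u <- s2) fine (P (z u @^-1` B u)))%:E)%E.
Proof.
have mBs (s : seq vertex) (B' : vertex -> set (nat -> \bar R)) :
    (forall u, eval_sigma setT (B' u)) ->
    measurable (\bigcap_(u in [set` s]) (z u @^-1` B' u)).
  move=> sB; apply: fin_bigcap_measurable => // u _.
  exact: z_preimage_measurable.
elim: s1 s2 B => [|[u k] s1 ih] s2 B.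
  rewrite /= => us2 sB; rewrite !big_nil mul1r; under eq_integral do rewrite big_nil mul1r.
  rewrite integral_indic ?setIT//; last exact: mBs.
  apply: (etrans (z_indep us2 sB)); rewrite -prodEFin; apply: eq_bigr => v _.
  by rewrite fineK// fin_num_measure//; exact: z_preimage_measurable.
rewrite /= => /andP[us uss] sB; rewrite big_cons/=.
under eq_integral do rewrite big_cons/= -mulrA.
rewrite -mulrA EFinM -alphaE.
rewrite -(@integral_coord (EFin \o g) u k)//; last exact/measurable_EFinP.
apply: (@integral_indep _ _ _ _ (fun w => z u w k) _ g
   (fun w => (\prod_(x <- s1) g (z x.1 w x.2)) *
      \1_(\bigcap_(u in [set` s2]) (z u @^-1` B u)) w)) => //.
- apply: measurable_funM; last by apply: measurable_indic; exact: mBs.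
  by apply: measurable_prod => i _; exact: mgz.
- by move=> w; rewrite mulr_ge0// prodr_ge0.
move=> A mA.
pose B' v := if v == u then [set f : nat -> \bar R | A (f k)] else B v.
have us2 : u \notin s2 by move: us; rewrite mem_cat negb_or => /andP[].
have us1 : u \notin map fst s1 by move: us; rewrite mem_cat negb_or => /andP[].
have sB' v : eval_sigma setT (B' v).
  by rewrite /B'; case: ifP => // _; exact: eval_sigma_coord.
have := ih (u :: s2) B' _ sB'; rewrite -cat_rcons.
have -> : uniq (rcons [seq i.1 | i <- s1] u ++ s2).
  by rewrite -cats1 -catA uniq_catCA/= us.
have B'u : B' u = [set f : nat -> \bar R | A (f k)] by rewrite /B' eqxx.
move=> /(_ isT); rewrite big_cons B'u.
have -> : \prod_(j <- s2) fine (P (z j @^-1` B' j)) =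
   \prod_(j <- s2) fine (P (z j @^-1` B j)).
  apply: eq_big_seq => v vs2; rewrite /B'; case: eqVneq => // vu.
  by rewrite -vu vs2 in us2.
rewrite mulrCA EFinM fineK ?fin_num_measure//; last first.
  by rewrite -[X in measurable X]setTI; exact: z_measurable.
move=> <-; apply: eq_integral => w _; congr EFin.
rewrite mulrCA; congr (_ * _).
rewrite -[LHS]/((\1_((fun w => z u w k) @^-1` A) \* _) w) -indicI.
congr (\1_ _ w); apply/seteqP; split => [w' [Aw Bw] v|w' h].
  rewrite /= inE => /orP[/eqP->|vs2]; rewrite /B' ?eqxx//=.
  by case: eqVneq vs2 us2 => [->->//|_ vs2 _]; exact: Bw.
split.
  by have := h u (mem_head _ _); rewrite /B' eqxx.
move=> v /= vs2; have := h v; rewrite /= inE vs2 orbT => /(_ isT).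
by rewrite /B'; case: eqVneq vs2 us2 => // -> ->.
Qed.

(** For [g = expR_alive theta] and [v] the root, this is the sum of [exp (theta V(u))] over the
    living [|u| = n], nested by generations. *)
Fixpoint branching_sum (n : nat) (v : vertex) (w : T) : \bar R :=
  if n is n'.+1 then
    \sum_(0 <= k <oo) ((g (z v w k))%:E * branching_sum n' (rcons v k) w)%E
  else 1%E.

Lemma branching_sum_ge0 n v w : (0 <= branching_sum n v w)%E.
Proof.
elim: n v => [|n ih] v //=.
by apply: nneseries_ge0 => k _ _; rewrite mule_ge0// lee_fin.
Qed.

Lemma measurable_branching_sum n v : measurable_fun setT (branching_sum n v).
Proof.
elim: n v => [|n ih] v /=; first exact: measurable_cst.
apply: ge0_emeasurable_sum => [k w _ _|k _].
  by rewrite mule_ge0 ?lee_fin ?branching_sum_ge0.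
by apply: emeasurable_funM => //; exact/measurable_EFinP.
Qed.

Variable e : R.
Hypothesis sum_alpha : (\sum_(0 <= k <oo) (alpha k)%:E = e%:E)%E.

(** The product over [s] holds the factors met on the way down to [v]. They lie outside the subtree
    of [v] and are carried to the last generation, where [path_integral] evaluates them all
    together. *)
Lemma branching_sum_moment n (s : seq (vertex * nat)) v :
    uniq (map fst s) -> all (fun x => ~~ prefix v x.1) s ->
  (\int[P]_w ((\prod_(x <- s) g (z x.1 w x.2))%:E * branching_sum n v w) =
   (\prod_(x <- s) alpha x.2 * e ^+ n)%:E)%E.
Proof.
have mprod (s' : seq (vertex * nat)) :
    measurable_fun setT (fun w => (\prod_(x <- s') g (z x.1 w x.2))%:E).
  by apply/measurable_EFinP; apply: measurable_prod => i _; exact: mgz.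
elim: n s v => [|n ih] s v us vs.
  have sT : eval_sigma setT (setT : set (nat -> \bar R)).
    have := @eval_sigma_coord 0 setT measurableT.
    by congr (eval_sigma _ _); apply/seteqP; split.
  have := @path_integral s [::] (fun _ => setT); rewrite cats0 big_nil.
  move=> /(_ us (fun _ => sT)); rewrite expr0 !mulr1 => <-.
  apply: eq_integral => w _ /=; rewrite mule1; congr EFin.
  rewrite indicE mem_set ?mulr1//.
rewrite /=.
under eq_integral => w _.
  rewrite -nneseriesZl; last first.
    by move=> k _; rewrite mule_ge0 ?lee_fin ?branching_sum_ge0.
  over.
rewrite integral_nneseries//; last 2 first.
- move=> k; apply: emeasurable_funM => //; apply: emeasurable_funM => //.
    exact/measurable_EFinP.
  exact: measurable_branching_sum.
- move=> k w _; rewrite mule_ge0 ?lee_fin ?prodr_ge0//.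
  by rewrite mule_ge0 ?lee_fin ?branching_sum_ge0.
have E k : (\int[P]_w ((\prod_(x <- s) g (z x.1 w x.2))%:E *
     ((g (z v w k))%:E * branching_sum n (rcons v k) w)) =
     (\prod_(x <- s) alpha x.2 * e ^+ n)%:E * (alpha k)%:E)%E.
  rewrite -EFinM mulrC mulrA -(big_cons _ _ (v, k) s xpredT (fun x => alpha x.2)).
  rewrite -(ih ((v, k) :: s) (rcons v k)).
  - by apply: eq_integral => w _; rewrite big_cons/= EFinM muleA; congr (_ * _)%E; exact: muleC.
  - rewrite /= us andbT; apply/negP => /mapP[x xs vx].
    by have := allP vs x xs; rewrite -vx prefix_refl.
  - rewrite /=; apply/andP; split.
      by apply/negP => /size_prefix; rewrite size_rcons ltnn.
    by apply: sub_all vs => x; apply: contra; exact: prefix_rconsl.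
rewrite (eq_eseriesr (fun k _ => E k)) nneseriesZl; last first.
  by move=> k _; rewrite lee_fin alpha_ge0.
by rewrite sum_alpha -EFinM exprSr mulrA.
Qed.

Lemma expectation_branching_sum n :
  (\int[P]_w branching_sum n [::] w = (e ^+ n)%:E)%E.
Proof.
have := @branching_sum_moment n [::] [::]; rewrite big_nil mul1r => <- //.
by apply: eq_integral => w _; rewrite big_nil mul1e.
Qed.

End FirstMoment.

(** * The transform of the walk and Markov's inequality *)

Section ExponentialMoments.
Variables (R : realType) (d : measure_display) (T : measurableType d).
Variables (P : probability T R) (z : vertex -> T -> nat -> \bar R).
Hypothesis z_measurable : forall u k, measurable_fun setT (fun w => z u w k).
Hypothesis z_indep : mutually_independent P (eval_sigma setT) z.
Hypothesis z_ident : forall u v, same_law P P (eval_sigma setT) (z u) (z v).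
Hypothesis z_lt_pinfty : forall u w k, (z u w k < +oo)%E.

(* A dead vertex contributes 0, also when [theta = 0]. *)
Definition expR_alive (theta : R) (r : \bar R) : R :=
  if r \is a fin_num then expR (theta * fine r) else 0.

Lemma expR_alive_ge0 theta r : 0 <= expR_alive theta r.
Proof. by rewrite /expR_alive; case: ifP => // _; exact: expR_ge0. Qed.

Lemma measurable_expR_alive theta : measurable_fun setT (expR_alive theta).
Proof.
apply: measurable_fun_ifT => //.
- apply: (measurable_fun_bool true).
  have := @emeasurable_fin_num _ _ R setT id measurableT (@measurable_id _ _ _).
  rewrite setTI; congr (measurable _).
- apply: measurableT_comp; first exact: measurable_expR.
  by apply: measurable_funM => //; exact: fine_measurable.
Qed.

Lemma expR_aliveD theta (x y : \bar R) : x \is a fin_num -> y \is a fin_num ->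
  expR_alive theta (x + y) = expR_alive theta x * expR_alive theta y.
Proof.
by move=> fx fy; rewrite /expR_alive fin_numD fx fy/= fineD// mulrDr expRD.
Qed.

Definition child_moment theta (k : nat) : \bar R :=
  (\int[P]_w (expR_alive theta (z [::] w k))%:E)%E.

Definition total_moment theta : \bar R := (\sum_(0 <= k <oo) child_moment theta k)%E.

Lemma child_moment_ge0 theta k : (0 <= child_moment theta k)%E.
Proof. by apply: integral_ge0 => w _; rewrite lee_fin expR_alive_ge0. Qed.

Lemma total_moment_ge0 theta : (0 <= total_moment theta)%E.
Proof. by apply: nneseries_ge0 => k _ _; exact: child_moment_ge0. Qed.

Lemma V_singleton w k : V z w [:: k] = z [::] w k.
Proof. by rewrite /V big_ord_recl big_ord0 adde0. Qed.

Lemma psiE theta : psi P z theta = lne (total_moment theta).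
Proof.
congr lne; rewrite /total_moment /child_moment -integral_nneseries//; last first.
- by move=> k w _; rewrite lee_fin expR_alive_ge0.
- move=> k; apply/measurable_EFinP.
  by apply: measurableT_comp => //; exact: measurable_expR_alive.
apply: eq_integral => w _.
rewrite nneseries_esumT; last by move=> k; rewrite lee_fin expR_alive_ge0.
rewrite (_ : \esum_(u in _) _ =
    \esum_(k in [set k | z [::] w k != -oo%E]) expeR (theta%:E * z [::] w k)).
  rewrite esum_mkcond; apply: eq_esum => k _.
  have := z_lt_pinfty [::] w k; case: ifPn => [|/negP]; rewrite inE/=.
    by case: (z [::] w k) => // r _ _; rewrite /expR_alive/=.
  by move=> /negP; rewrite negbK => /eqP ->.
rewrite (reindex_esum [set k | z [::] w k != -oo%E] _ (fun k => [:: k])).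
  by apply: eq_esum => k _; rewrite V_singleton.
split.
- by move=> k /= zk; split => //; rewrite /mkset V_singleton.
- by move=> k l _ _ [].
- move=> [|k [|j l]] [] // _; rewrite /mkset V_singleton => zk; by exists k.
Qed.

Lemma measurable_M n : measurable_fun setT (M z n).
Proof.
(* Enumerating the words makes [M] a countable supremum; codes of no word, or of a word of another
   length, get the neutral value -oo. *)
pose f (i : nat) w : \bar R := if @unpickle (seq nat) i is Some u then
  if size u == n then V z w u else -oo%E else -oo%E.
have -> : M z n = (fun w => esups (f^~ w) 0).
  apply/funext => w; rewrite /M /esups /sdrop; apply/eqP; rewrite eq_le.
  apply/andP; split; apply: ge_ereal_sup => x.
    move=> [u [/= un _] <-]; apply: ereal_sup_ubound => /=; exists (pickle u) => //.
    by rewrite /f pickleK; move: un; rewrite /generation/= => ->; rewrite eqxx.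
  move=> [i _ <-]; rewrite /f; case: unpickle => [u|]; last exact: leNye.
  case: eqP => [un|_]; last exact: leNye.
  have [->|Vu] := eqVneq (V z w u) -oo%E; first exact: leNye.
  by apply: ereal_sup_ubound; exists u.
apply: measurable_fun_esups => i; rewrite /f.
case: unpickle => [u|]; last exact: measurable_cst.
case: eqP => _; last exact: measurable_cst.
by apply: emeasurable_sum => j; exact: z_measurable.
Qed.

Lemma measurable_M_tail n y : measurable [set w | (y%:E <= M z n w)%E].
Proof.
have := emeasurable_fun_c_infty measurableT (@measurable_M n) y%:E.
by rewrite setTI.
Qed.

(** A path is one of the nonnegative terms of the nested series, and a path that dies contributes
    0. *)
Lemma path_le_branching_sum theta n v u w : size u = n ->
  ((expR_alive theta (\sum_(i < n) z (v ++ take i u) w (nth 0%N u i))%E)%:E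
     <= branching_sum z (expR_alive theta) n v w)%E.
Proof.
elim: n v u => [|n ih] v [|k u]//=.
  by rewrite big_ord0 /expR_alive/= mulr0 expR0.
move=> [un]; rewrite big_ord_recl/= cats0.
set S := (\sum_(i < n) _)%E.
have SE : S = (\sum_(i < n) z (rcons v k ++ take i u) w (nth 0%N u i))%E.
  by apply: eq_bigr => i _; rewrite -cats1 -catA.
have Sy : (S < +oo)%E by apply: lte_sum_pinfty => i _; exact: z_lt_pinfty.
have zy := z_lt_pinfty v w k.
have bge0 j : (0 <= (expR_alive theta (z v w j))%:E *
    branching_sum z (expR_alive theta) n (rcons v j) w)%E.
  rewrite mule_ge0 ?lee_fin ?expR_alive_ge0//.
  by apply: branching_sum_ge0 => r; exact: expR_alive_ge0.
have [fz|] := boolP (z v w k \is a fin_num); last first.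
  rewrite fin_numE negb_and !negbK (lt_eqF zy) orbF => /eqP ->.
  by rewrite /= {1}/expR_alive/=; apply: nneseries_ge0 => j _ _.
have [fS|] := boolP (S \is a fin_num); last first.
  rewrite fin_numE negb_and !negbK (lt_eqF Sy) orbF => /eqP ->.
  by rewrite addeNy {1}/expR_alive/=; apply: nneseries_ge0 => j _ _.
rewrite expR_aliveD// EFinM.
apply: (@le_trans _ _ (\sum_(0 <= j < k.+1) ((expR_alive theta (z v w j))%:E *
    branching_sum z (expR_alive theta) n (rcons v j) w))%E); last first.
  by apply: nneseries_lim_ge => j _ _.
rewrite big_nat_recr//=.
apply: (@le_trans _ _ ((expR_alive theta (z v w k))%:E *
    branching_sum z (expR_alive theta) n (rcons v k) w)%E).
  by apply: lee_wpmul2l; [rewrite lee_fin expR_alive_ge0|rewrite SE; exact: ih].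
by rewrite leeDr// sume_ge0.
Qed.

Lemma M_tail_le_branching_sum theta n y w : 0 <= theta -> (y%:E <= M z n w)%E ->
  ((expR (theta * y))%:E <= branching_sum z (expR_alive theta) n [::] w)%E.
Proof.
move=> t0 yM.
set W := branching_sum _ _ _ _ _.
have W0 : (0 <= W)%E by apply: branching_sum_ge0 => r; exact: expR_alive_ge0.
(* [M] is a supremum over a possibly infinite generation and need not be attained, so the bound is
   first obtained at [y - eps]. *)
have step eps : 0 < eps -> ((expR (theta * (y - eps)))%:E <= W)%E.
  move=> eps0.
  have : ((y - eps)%:E < M z n w)%E.
    by rewrite (lt_le_trans _ yM)// lte_fin ltrBlDr ltrDl.
  move=> /ereal_sup_gt[_ [u [un Vu] <-] yV].
  apply: (@le_trans _ _ (expR_alive theta (V z w u))%:E); last first.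
    have := @path_le_branching_sum theta n [::] u w un.
    by rewrite /V; move: un; rewrite /generation/= => ->.
  have Vy : (V z w u < +oo)%E by apply: lte_sum_pinfty => i _; exact: z_lt_pinfty.
  move: Vu yV Vy; rewrite /mkset; case: (V z w u) => [r| |]//= _.
  by rewrite lte_fin lee_fin => yr _; rewrite /expR_alive/= ler_expR ler_wpM2l// ltW.
case: W W0 step => [r| |]// W0 step; last by rewrite leey.
rewrite lee_fin leNgt; apply/negP => rlt.
have := step 1 ltr01; rewrite lee_fin => r0.
have {}r0 : 0 < r by rewrite (lt_le_trans _ r0) ?expR_gt0.
have [t00|t00] := eqVneq theta 0.
  by have := step 1 ltr01; rewrite lee_fin t00 mul0r leNgt; move: rlt; rewrite t00 mul0r => ->.
have tpos : 0 < theta by rewrite lt_def t00.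
have lnr : ln r < theta * y by rewrite -ltr_expR lnK.
(* This [eps] places [theta * (y - eps)] halfway between [ln r] and [theta * y]. *)
have := step ((theta * y - ln r) / (2 * theta)).
rewrite divr_gt0 ?mulr_gt0 ?subr_gt0// => /(_ isT).
rewrite lee_fin -{2}(lnK r0) ler_expR.
have -> : theta * (y - (theta * y - ln r) / (2 * theta)) =
   (theta * y + ln r) / 2 by field.
lra.
Qed.

Lemma M_tail_upper theta n y (e : R) : 0 <= theta -> total_moment theta = e%:E ->
  (P [set w | (y%:E <= M z n w)%E] <= (expR (- (theta * y)) * e ^+ n)%:E)%E.
Proof.
move=> t0 etot.
have fink k : child_moment theta k \is a fin_num.
  rewrite ge0_fin_numE ?child_moment_ge0//.
  apply: (@le_lt_trans _ _ (total_moment theta)); last by rewrite etot ltry.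
  apply: (@le_trans _ _ (\sum_(0 <= j < k.+1) child_moment theta j)%E).
    rewrite big_nat_recr//= leeDr// sume_ge0// => j _; exact: child_moment_ge0.
  by apply: nneseries_lim_ge => j _ _; exact: child_moment_ge0.
have alphaE k : (\int[P]_w (expR_alive theta (z [::] w k))%:E =
    (fine (child_moment theta k))%:E)%E by rewrite fineK.
have sumE : (\sum_(0 <= k <oo) (fine (child_moment theta k))%:E = e%:E)%E.
  by rewrite -etot; apply: eq_eseriesr => k _; rewrite fineK.
have EW := expectation_branching_sum z_measurable z_indep z_ident
  (measurable_expR_alive theta) (expR_alive_ge0 theta) alphaE sumE n.
set A := [set w | _].
have mA : measurable A by exact: measurable_M_tail.
rewrite EFinM -EW expRN lee_pdivlMl ?expR_gt0//.
rewrite -[A in P A]setIT -(integral_indic P measurableT mA).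
rewrite -ge0_integralZl_EFin ?expR_ge0//; last first.
  by apply/measurable_EFinP; exact: measurable_indic.
apply: ge0_le_integral => //.
- apply/measurable_EFinP; apply: measurable_funM => //; exact: measurable_indic.
- apply: measurable_branching_sum => //; [exact: measurable_expR_alive|exact: expR_alive_ge0].
move=> w _; have [wA|wA] := boolP (w \in A).
  by rewrite indicE wA mule1; apply: M_tail_le_branching_sum => //; rewrite inE in wA.
rewrite indicE (negPf wA) mule0; apply: branching_sum_ge0; exact: expR_alive_ge0.
Qed.

End ExponentialMoments.

(** * Truncation and the lower tail bound *)

Section Truncation.
Variable R : realType.
Variable v : nat -> R.

(** Rounding down to the grid [v 0, ..., v (N - 1)]; a position below the whole grid counts as
    dead. *)
Definition trunc (N : nat) (r : \bar R) : \bar R :=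
  \big[Order.max/-oo%E]_(i < N | ((v i)%:E <= r)%E) (v i)%:E.

Lemma trunc_le N r : (trunc N r <= r)%E.
Proof. by apply: bigmax_le => //; exact: leNye. Qed.

Lemma trunc_homo r : {homo trunc^~ r : m n / (m <= n)%N >-> (m <= n)%E}.
Proof.
move=> m n mn.
exact: (@le_bigmax_ord _ _ -oo%E m n (fun i => ((v i)%:E <= r)%E)
  (fun i => (v i)%:E)).
Qed.

Lemma le_trunc N i r : (i < N)%N -> ((v i)%:E <= r)%E -> ((v i)%:E <= trunc N r)%E.
Proof.
move=> iN vr; exact: (@le_bigmax_cond _ _ _ -oo%E (Ordinal iN)
  (fun i => ((v i)%:E <= r)%E) (fun i => (v i)%:E)).
Qed.

Section Types.
Variables K N : nat.

(* For each of the first [K] children, the set of thresholds below its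
   position. *)
Definition threshold_type (f : nat -> \bar R) : {set 'I_K * 'I_N} :=
  [set a : 'I_K * 'I_N | ((v a.2)%:E <= f a.1)%E].

Definition threshold_value (t : {set 'I_K * 'I_N}) (k : 'I_K) : \bar R :=
  \big[Order.max/-oo%E]_(i < N | (k, i) \in t) (v i)%:E.

Lemma threshold_valueE f (k : 'I_K) :
  threshold_value (threshold_type f) k = trunc N (f k).
Proof. by apply: eq_bigl => i; rewrite inE. Qed.

Lemma threshold_value_le f (k : 'I_K) :
  (threshold_value (threshold_type f) k <= f k)%E.
Proof. by rewrite threshold_valueE trunc_le. Qed.

Lemma threshold_type_measurable t :
  eval_sigma setT (threshold_type @^-1` [set t]).
Proof.
pose G := \bigcup_(i in [set: nat])
  preimage_set_system setT (fun f : nat -> \bar R => f i) (@measurable _ (\bar R)).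
pose A (a : 'I_K * 'I_N) : set (nat -> \bar R) := [set f | ((v a.2)%:E <= f a.1)%E].
have mA a : @measurable _ (g_sigma_algebraType G) (A a).
  apply: (@eval_sigma_coord R a.1 [set r | ((v a.2)%:E <= r)%E]).
  rewrite -[X in measurable X]setTI.
  apply: (@emeasurable_fun_c_infty _ _ R setT id) => //.
have -> : threshold_type @^-1` [set t] =
    \bigcap_(a in [set: ('I_K * 'I_N)%type]) (if a \in t then A a else ~` A a).
  apply/seteqP; split => f.
    move=> <- a _; rewrite inE; case: ifPn => // h; exact/negP.
  move=> h; apply/setP => a; rewrite inE; have := h a I; case: ifP => // _ /negP.
  by move/negbTE.
apply: (@fin_bigcap_measurable _ (g_sigma_algebraType G)); first exact: finite_finset.
by move=> a _; case: ifP => // _; exact: measurableC.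
Qed.

End Types.
End Truncation.

(** * Rational thresholds and pointwise removal of the truncation *)

Section Dense.
Variable R : realType.

Definition rationals (i : nat) : R := if @unpickle rat i is Some q then ratr q else 0.

Lemma rationals_dense (a b : R) : a < b -> exists i, a < rationals i < b.
Proof.
move=> /rat_in_itvoo[q]; rewrite in_itv/= => qab.
by exists (pickle q); rewrite /rationals pickleK.
Qed.

Lemma cvg_trunc_expR_alive theta (r : \bar R) : (r < +oo)%E ->
  (expR_alive theta (trunc rationals n r))%:E @[n --> \oo] --> (expR_alive theta r)%:E.
Proof.
case: r => [r _| //| _]; last first.
  have h n : trunc rationals n -oo%E = -oo%E.
    by apply/eqP; rewrite eq_le leNye andbT trunc_le.
  by under eq_fun do rewrite h; exact: cvg_cst.
have ev a : a < r -> \forall n \near \oo, ((a%:E < trunc rationals n r%:E)%E).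
  move=> /rationals_dense[i /andP[ai ir]]; near=> n.
  apply: (@lt_le_trans _ _ (rationals i)%:E); first by rewrite lte_fin.
  apply: le_trunc; last by rewrite lee_fin ltW.
  by near: n; exact: nbhs_infty_gt.
have fin : \forall n \near \oo, trunc rationals n r%:E \is a fin_num.
  near=> n.
  have h1 : (trunc rationals n r%:E <= r%:E)%E by exact: trunc_le.
  have h2 : ((r - 1)%:E < trunc rationals n r%:E)%E.
    by near: n; apply: ev; rewrite ltrBlDr ltrDl.
  by move: h1 h2; case: (trunc _ _ _).
have cf : fine (trunc rationals n r%:E) @[n --> \oo] --> r.
  apply/cvgrPdist_lt => e e0; near=> n.
  have h1 : (trunc rationals n r%:E <= r%:E)%E by exact: trunc_le.
  have h2 : ((r - e)%:E < trunc rationals n r%:E)%E.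
    by near: n; apply: ev; rewrite ltrBlDr ltrDl.
  move: h1 h2; case: (trunc _ _ _) => //= s; rewrite lee_fin lte_fin => h1 h2.
  rewrite ger0_norm ?subr_ge0//; lra.
apply: (@cvg_trans _ ((expR (theta * fine (trunc rationals n r%:E)))%:E @[n --> \oo])).
  apply: near_eq_cvg; near=> n; rewrite /expR_alive ifT//; near: n; exact: fin.
rewrite /expR_alive/=; apply: cvg_EFin; first by near=> n.
apply: (@continuous_cvg _ _ _ _ _ _ (fun s => expR (theta * s))) cf.
apply: (@continuous_comp _ _ _ (fun s => theta * s) (@expR R)).
  exact: mulrl_continuous.
exact: continuous_expR.
Unshelve. all: by end_near. Qed.

Lemma expR_alive_homo theta (r s : \bar R) : 0 <= theta -> (s < +oo)%E -> (r <= s)%E ->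
  expR_alive theta r <= expR_alive theta s.
Proof.
move=> t0; case: s => [s| |]; case: r => [r| |]//= _; rewrite /expR_alive/=.
  by rewrite lee_fin => rs; rewrite ler_expR ler_wpM2l.
by move=> _; exact: expR_ge0.
Qed.

End Dense.

(** * Truncated transforms and the geometric lower bound *)

Section LowerBound.
Variables (R : realType) (d : measure_display) (T : measurableType d).
Variables (P : probability T R) (z : vertex -> T -> nat -> \bar R).
Hypothesis z_measurable : forall u k, measurable_fun setT (fun w => z u w k).
Hypothesis z_indep : mutually_independent P (eval_sigma setT) z.
Hypothesis z_ident : forall u v, same_law P P (eval_sigma setT) (z u) (z v).
Hypothesis z_lt_pinfty : forall u w k, (z u w k < +oo)%E.
Variable x : R.

Section Level.
Variables (v : nat -> R) (K N : nat).

Let tau := @threshold_type R v K N.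
Let tauP := @threshold_type_measurable R v K N.
Let D := @threshold_value R v K N.

Definition level_prob : {set 'I_K * 'I_N} -> R := type_prob P z tau.

(** Indexing by a type and a child slot turns the truncated reproduction law into the weighted
    displacements of [laplace]; a discarded child has weight 0. *)
Definition level_weight (j : {set 'I_K * 'I_N} * 'I_K) : R :=
  level_prob j.1 * (D j.1 j.2 != -oo%E)%:R.

Definition level_shift (j : {set 'I_K * 'I_N} * 'I_K) : R := fine (D j.1 j.2) - x.

Lemma level_weight_ge0 j : 0 <= level_weight j.
Proof. by rewrite mulr_ge0// type_prob_ge0. Qed.

Lemma threshold_value_lt t k : (D t k < +oo)%E.
Proof.
apply: (big_ind (fun y => (y < +oo)%E)) => // [a b ha hb|i _]; last exact: ltry.
by rewrite gt_max ha.
Qed.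

Lemma sum_level (f : R -> R) : \sum_j level_weight j * f (level_shift j) =
  \sum_t level_prob t * \sum_(k < K | D t k != -oo%E) f (fine (D t k) - x).
Proof.
rewrite -(pair_bigA _ (fun t k => level_weight (t, k) * f (level_shift (t, k)))).
apply: eq_bigr => t _; rewrite mulr_sumr [RHS]big_mkcond/=.
apply: eq_bigr => k _; rewrite /level_weight/=.
by case: ifP => _; rewrite ?mulr1// mulr0 mul0r.
Qed.

Lemma laplace_levelE theta : (laplace level_weight level_shift theta)%:E =
  ((expR (- (theta * x)))%:E *
   \sum_(k < K) \int[P]_w (expR_alive theta (trunc v N (z [::] w k)))%:E)%E.
Proof.
have E (k : 'I_K) : (\int[P]_w (expR_alive theta (trunc v N (z [::] w k)))%:E =
    (\sum_t level_prob t * expR_alive theta (D t k))%:E)%E.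
  rewrite -(integral_type z_measurable z_ident tauP (h := fun t => expR_alive theta (D t k)) [::]).
    by apply: eq_integral => w _; rewrite /D threshold_valueE.
  by move=> t; exact: expR_alive_ge0.
under eq_bigr do rewrite E.
rewrite sumEFin -EFinM; congr EFin; rewrite /laplace.
rewrite (sum_level (fun y => expR (theta * y))) exchange_big/= mulr_sumr.
apply: eq_bigr => t _; rewrite -mulr_sumr mulrCA; congr (_ * _).
rewrite mulr_sumr [LHS]big_mkcond/=; apply: eq_bigr => k _.
have := threshold_value_lt t k; rewrite /expR_alive; case: (D t k) => [r| |]//= _.
  by rewrite mulrBr addrC expRD.
by rewrite mulr0.
Qed.

Lemma tail_lower (rho rho1 bound : R) (phi : R -> R) (n0 : nat) (c0 : R) :
    0 < rho -> rho <= 1 -> rho < rho1 -> (forall y, 0 <= phi y <= bound) ->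
    0 < phi 0 ->
    (forall y, rho1 * phi y <= \sum_j level_weight j * phi (y - level_shift j)) ->
    0 < c0 -> (forall y, c0 * phi y <= survive level_prob D n0 (n0%:R * x + y)) ->
  exists c : R, 0 < c /\ forall n, (n0 <= n)%N ->
    ((c * rho ^+ n)%:E <= P [set w | ((n%:R * x)%:E <= M z n w)%E])%E.
Proof.
move=> r0 r1 rr phib phi0 sub c00 init.
have [|c c_gt0 H] := @survive_ge R _ K level_prob D
  (type_prob_ge0 P z tau) (type_prob_sum1 z_measurable z_ident tauP)
  x rho rho1 bound phi n0 c0 r0 r1 rr phib _ c00 init.
  by move=> y; rewrite -(sum_level (fun s => phi (y - s))).
exists (c * phi 0); split; first exact: mulr_gt0.
move=> n n0n; have [mS PS] := survivor_prob z_measurable z_indep z_ident D tauP n (n%:R * x).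
apply: (@le_trans _ _ (P [set w | survivor z tau D n [::] (n%:R * x) w])).
  rewrite PS lee_fin; have := H (n - n0)%N 0.
  rewrite subnKC// addr0; apply: le_trans.
  (* As [rho <= 1], [rho ^+ n <= rho ^+ (n - n0)], so the initial [n0] generations cost nothing. *)
  rewrite mulrAC ler_wpM2r// ?(ltW phi0)//.
  rewrite ler_wpM2l ?(ltW c_gt0)// -{1}(subnK n0n) exprD ler_piMr//.
    by rewrite exprn_ge0// ltW.
  by rewrite exprn_ile1// ltW.
apply: le_measure; rewrite ?inE//; first exact: measurable_M_tail.
move=> w; apply: survivor_M => //; exact: threshold_value_le.
Qed.

End Level.

(** One parameter bounds both the children kept and the thresholds, so the transforms are
    nondecreasing in [n] at each [theta >= 0]. *)
Let lap n := laplace (@level_weight (rationals R) n n) (@level_shift (rationals R) n n).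

Let Itr theta k n := (\int[P]_w (expR_alive theta (trunc (rationals R) n (z [::] w k)))%:E)%E.

Let mtrunc n k : measurable_fun setT (fun w => trunc (rationals R) n (z [::] w k)).
Proof.
rewrite /trunc; under eq_fun do rewrite big_mkcond/=.
elim: (index_enum _) => [|i s ih]; first by under eq_fun do rewrite big_nil; exact: measurable_cst.
under eq_fun do rewrite big_cons.
apply: measurable_maxe => //.
apply: measurable_fun_ifT; [|exact: measurable_cst|exact: measurable_cst].
apply: (measurable_fun_bool true).
have := emeasurable_fun_c_infty measurableT (z_measurable [::] k) (rationals R i)%:E.
by rewrite setTI.
Qed.

Let mItr theta n k : measurable_fun setT
  (fun w => (expR_alive theta (trunc (rationals R) n (z [::] w k)))%:E).
Proof.
apply/measurable_EFinP; apply: (measurableT_comp (measurable_expR_alive theta)).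
exact: mtrunc.
Qed.

Let Itr_ge0 theta k n : (0 <= Itr theta k n)%E.
Proof. by apply: integral_ge0 => w _; rewrite lee_fin expR_alive_ge0. Qed.

Let trunc_lt n w k : (trunc (rationals R) n (z [::] w k) < +oo)%E.
Proof. exact: le_lt_trans (trunc_le _ _ _) (z_lt_pinfty _ _ _). Qed.

Let Itr_homo theta k m n : 0 <= theta -> (m <= n)%N ->
  (Itr theta k m <= Itr theta k n)%E.
Proof.
move=> t0 mn; apply: ge0_le_integral => //.
- by move=> w _; rewrite lee_fin expR_alive_ge0.
- move=> w _; rewrite lee_fin expR_alive_homo//; exact: trunc_homo.
Qed.

Let lap_homo theta m n : 0 <= theta -> (m <= n)%N -> lap m theta <= lap n theta.
Proof.
move=> t0 mn; rewrite -lee_fin /lap !laplace_levelE; apply: lee_wpmul2l.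
  by rewrite lee_fin expR_ge0.
rewrite -(big_mkord xpredT (Itr theta ^~ m)) -(big_mkord xpredT (Itr theta ^~ n)).
rewrite [leRHS](big_cat_nat (n := m))//=.
apply: (@le_trans _ _ (\sum_(0 <= k < m) Itr theta k n)%E).
  by apply: lee_sum => k _; exact: Itr_homo.
by rewrite leeDl// sume_ge0.
Qed.

Let cvg_Itr theta k : 0 <= theta -> Itr theta k n @[n --> \oo] --> child_moment P z theta k.
Proof.
move=> t0.
have -> : child_moment P z theta k = (\int[P]_w
    limn (fun n => (expR_alive theta (trunc (rationals R) n (z [::] w k)))%:E))%E.
  apply: eq_integral => w _; apply/esym/cvg_lim => //.
  exact: cvg_trunc_expR_alive.
apply: cvg_monotone_convergence => //.
- by move=> n w _; rewrite lee_fin expR_alive_ge0.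
- by move=> w _ m n mn; rewrite lee_fin expR_alive_homo//; exact: trunc_homo.
Qed.

(** The first [K] children are all kept once [n >= K], so each partial sum of [total_moment] is a
    limit of sums controlled by the truncated transforms. *)
Lemma total_moment_le (rho theta : R) : 0 <= theta -> (forall n, lap n theta <= rho) ->
  (total_moment P z theta <= (rho * expR (theta * x))%:E)%E.
Proof.
move=> t0 lr.
have E0 k : (0 <= child_moment P z theta k)%E by exact: child_moment_ge0.
apply: lime_le; first exact: is_cvg_nneseries.
apply: nearW => K; rewrite /= big_mkord.
have cv : (\sum_(k < K) Itr theta k n)%E @[n --> \oo] -->
    (\sum_(k < K) child_moment P z theta k)%E.
  apply: cvg_nnesum => k _; first by apply: nearW => n; exact: Itr_ge0.
  exact: cvg_Itr.
apply: (cvge_to_le cv); near=> n.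
have Kn : (K <= n)%N by near: n; exact: nbhs_infty_ge.
have := lr n; rewrite -lee_fin /lap laplace_levelE => h.
apply: (@le_trans _ _ (\sum_(k < n) Itr theta k n)%E).
  rewrite -(big_mkord xpredT (Itr theta ^~ n)) -[leRHS](big_mkord xpredT (Itr theta ^~ n)).
  by rewrite [leRHS](big_cat_nat (n := K))//= leeDl// sume_ge0.
by rewrite mulrC EFinM -lee_pdivrMl ?expR_gt0// -expRN.
Unshelve. all: by end_near. Qed.

(** A coercivity bound uniform in the truncation, supplied by one child that passes above [x] with
    positive probability. It confines the points where the truncated transforms are small to a fixed
    compact interval. *)
Lemma level_laplace_ge k i : x < rationals R i ->
    (0 < P [set w | ((rationals R i)%:E <= z [::] w k)%E])%E ->
  exists n0 (w0 d0 : R), [/\ 0 < w0, 0 < d0 & forall n theta, (n0 <= n)%N -> 0 <= theta ->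
     w0 * expR (theta * d0) <= lap n theta].
Proof.
move=> xi; set A := [set w | _] => PA.
have mA : measurable A.
  have := emeasurable_fun_c_infty measurableT (z_measurable [::] k) (rationals R i)%:E.
  by rewrite setTI.
have fA : P A \is a fin_num by exact: fin_num_measure.
exists (maxn i k).+1, (fine (P A)), (rationals R i - x); split.
- by rewrite fine_gt0// PA ltey_eq fA.
- by rewrite subr_gt0.
move=> n theta; rewrite gtn_max => /andP[ni nk] t0.
rewrite -lee_fin /lap laplace_levelE.
rewrite (bigD1 (Ordinal nk))//=.
apply: (@le_trans _ _ ((expR (- (theta * x)))%:E *
   ((expR (theta * rationals R i))%:E * P A))%E).
  rewrite -{2}(fineK fA) -!EFinM lee_fin mulrBr addrC expRD; lra.
apply: lee_wpmul2l; first by rewrite lee_fin expR_ge0.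
apply: (@le_trans _ _ (Itr theta k n)); last first.
  by rewrite leeDl// sume_ge0// => j _; exact: Itr_ge0.
rewrite -[A]setIT -(integral_indic P measurableT mA).
rewrite -ge0_integralZl_EFin ?expR_ge0//; last first.
  by apply/measurable_EFinP; exact: measurable_indic.
apply: ge0_le_integral => //.
- apply/measurable_EFinP; apply: measurable_funM; first exact: measurable_cst.
  exact: measurable_indic.
move=> w _; have [wA|wA] := boolP (w \in A); last first.
  by rewrite indicE (negPf wA) mule0 lee_fin expR_alive_ge0.
rewrite indicE wA mule1 lee_fin.
rewrite inE in wA; have := expR_alive_homo t0 (trunc_lt n w k) (le_trunc ni wA).
by rewrite {1}/expR_alive.
Qed.

(** A Dini-type argument by contradiction: points [th n] with [lap n (th n) <= rho] would cluster at
    some [p] in [[0, Th]]. Monotonicity in [n] and continuity in [theta] then give [lap n p <= rho]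
    for every [n], against [total_moment_le]. *)
Lemma level_exists (rho : R) : 0 < rho ->
    (forall theta, 0 <= theta -> ((rho * expR (theta * x))%:E < total_moment P z theta)%E) ->
    (exists k i, x < rationals R i /\
       (0 < P [set w | ((rationals R i)%:E <= z [::] w k)%E])%E) ->
  exists n, forall theta, 0 <= theta -> rho < lap n theta.
Proof.
move=> rho0 hrho [k [i [xi /(level_laplace_ge xi)[n0 [w0 [d0 [w00 d00 large]]]]]]].
apply/not_existsP => H.
have {H} /choice[th thP] : forall n, exists theta, 0 <= theta /\ lap n theta <= rho.
  move=> n; have /existsNP[theta] := H n.
  by move=> /not_implyP[t0 /negP]; rewrite -leNgt => hl; exists theta.
pose Th := rho / (w0 * d0).
have wd : 0 < w0 * d0 by exact: mulr_gt0.
have thTh n : (n0 <= n)%N -> th n <= Th.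
  move=> n0n; have [t0 tl] := thP n.
  rewrite ler_pdivlMr//; have := le_trans (large n _ n0n t0) tl.
  have := ler_wpM2l (ltW w00) (expR_ge1Dx (th n * d0)); lra.
have FT : (th (n + n0)%N @[n --> \oo]) `[0, Th]%classic.
  exists 0%N => // n _; rewrite /= in_itv/= thTh ?leq_addl// andbT.
  by case: (thP (n + n0)%N).
have [p [pI pcl]] := @segment_compact R 0 Th _ _ FT.
have p0 : 0 <= p by move: pI; rewrite /= in_itv/= => /andP[].
suff hp n : lap n p <= rho.
  by have := total_moment_le p0 hp; rewrite leNgt hrho.
rewrite leNgt; apply/negP => lp.
have nb : nbhs p [set q | rho < lap n q].
  have := @continuous_laplace R _ (@level_weight (rationals R) n n)
    (@level_shift (rationals R) n n) p.
  move=> /cvgr_gt; exact.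
have Fn : (th (m + n0)%N @[m --> \oo]) [set th (m + n0)%N | m in [set m | (n <= m)%N]].
  by exists n => // m /= nm; exists m.
have [_ [[m /= nm <-]]] := pcl _ _ Fn nb.
have [tm lm] := thP (m + n0)%N.
rewrite /mkset ltNge => /negP; apply; apply: le_trans lm.
by apply: lap_homo => //; exact: leq_trans nm (leq_addr _ _).
Qed.

Definition tail_geometric (rho : R) := exists (c : R) (n0 : nat), 0 < c /\
  forall n, (n0 <= n)%N ->
    ((c * rho ^+ n)%:E <= P [set w | ((n%:R * x)%:E <= M z n w)%E])%E.

Lemma tail_geometric_above (rho : R) : 0 < rho -> rho <= 1 ->
    (forall theta, 0 <= theta -> ((rho * expR (theta * x))%:E < total_moment P z theta)%E) ->
    (exists k i, x < rationals R i /\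
       (0 < P [set w | ((rationals R i)%:E <= z [::] w k)%E])%E) ->
  tail_geometric rho.
Proof.
move=> rho0 rho1 hrho hpos.
have [N0 lapN0] := level_exists rho0 hrho hpos.
have [k0 [i0 [xi /(level_laplace_ge xi)[n0 [w0 [d0 [w00 d00 large]]]]]]] := hpos.
pose N := maxn N0 n0.
have lapN theta : 0 <= theta -> rho < lap N theta.
  by move=> t0; apply: (lt_le_trans (lapN0 _ t0)); apply: lap_homo => //; exact: leq_maxl.
set wt := @level_weight (rationals R) N N in lapN *.
set sh := @level_shift (rationals R) N N in lapN *.
have wt_ge0 : forall j, 0 <= wt j := @level_weight_ge0 (rationals R) N N.
have wd : exists j, 0 < wt j /\ 0 < sh j.
  apply/not_existsP => h.
  have wd0 : 0 < w0 * d0 by exact: mulr_gt0.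
  (* If no truncated step were positive, [lap N] would be nonincreasing; yet at this [theta] the
     bound [large] exceeds [lap N 0]. *)
  pose theta := lap N 0 / (w0 * d0).
  have l0 : 0 <= lap N 0 by rewrite ltW// (lt_trans rho0)// lapN.
  have t0 : 0 <= theta by rewrite divr_ge0// ltW.
  have : lap N theta <= lap N 0.
    apply: ler_sum => j _; rewrite -/(wt j) -/(sh j) mul0r expR0.
    have := wt_ge0 j; rewrite le_eqVlt => /orP[/eqP <-|wj]; first by rewrite !mul0r.
    rewrite ler_wpM2l// -expR0 ler_expR; apply: mulr_ge0_le0 => //.
    by rewrite leNgt; apply/negP => dj; apply: (h j).
  have := large N theta (leq_maxr _ _) t0.
  have := ler_wpM2l (ltW w00) (expR_ge1Dx (theta * d0)).
  have : theta * (w0 * d0) = lap N 0 by rewrite /theta mulfVK// gt_eqF.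
  lra.
have [phi [bound [width [rho2 [phib phi0 phiw rr sub]]]]] :=
  subsolution_exists wt_ge0 wd (ltW rho0) lapN.
have [[t k] [/= wj dj]] := wd.
set p := @level_prob (rationals R) N N.
set D := @threshold_value R (rationals R) N N.
have p_ge0 : forall t, 0 <= p t := type_prob_ge0 P z _.
have p_sum : \sum_t p t = 1 :=
  type_prob_sum1 z_measurable z_ident (threshold_type_measurable _ (K:=N) (N:=N)).
have Dtk : D t k != -oo%E.
  by move: wj; rewrite /wt /level_weight/=; case: eqP => //; rewrite mulr0 ltxx.
have pt : 0 < p t by move: wj; rewrite /wt /level_weight/= -/(D t k) Dtk mulr1.
(* After [n1] generations, following child [k] in families of type [t] gains at least [width] over
   slope [x]. So survival has probability at least [p t ^+ n1] wherever [phi] can be nonzero. *)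
pose n1 := Num.bound `|width / sh (t, k)|.
have n1w : width <= n1%:R * sh (t, k).
  rewrite -ler_pdivrMr//; apply: le_trans (ler_norm _) _.
  by rewrite ltW//; exact: archi_boundP.
have b0 : 0 < bound + 1.
  by have /andP[a b] := phib 0; rewrite (lt_le_trans ltr01)// lerDr (le_trans a b).
have [|c [c0 H]] := @tail_lower (rationals R) N N rho rho2 bound phi n1
    (p t ^+ n1 / (bound + 1)) rho0 rho1 rr phib phi0 sub (divr_gt0 (exprn_gt0 _ pt) b0).
  move=> y; have [wy|yw] := ltP width y.
    rewrite phiw// mulr0 subr_ge0.
    by case/andP: (extinct_bounds D p_ge0 p_sum n1 (n1%:R * x + y)).
  apply: (@le_trans _ _ (p t ^+ n1)).
    rewrite mulrAC ler_pdivrMr// ler_wpM2l ?exprn_ge0//.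
    by case/andP: (phib y) => _ /le_trans; apply; rewrite lerDl.
  apply: (le_trans (@survive_line _ _ _ p D p_ge0 p_sum t k n1 Dtk)).
  rewrite lerB// (@extinct_homo _ _ _ p D p_ge0 p_sum)//.
  have : n1%:R * sh (t, k) = n1%:R * fine (D t k) - n1%:R * x.
    by rewrite /sh /level_shift/= mulrBr.
  lra.
by exists c, n1.
Qed.

End LowerBound.

(** * The case where no displacement exceeds the slope *)

Section Edge.
Variables (R : realType) (d : measure_display) (T : measurableType d).
Variables (P : probability T R) (z : vertex -> T -> nat -> \bar R).
Hypothesis z_measurable : forall u k, measurable_fun setT (fun w => z u w k).
Hypothesis z_indep : mutually_independent P (eval_sigma setT) z.
Hypothesis z_ident : forall u v, same_law P P (eval_sigma setT) (z u) (z v).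
Hypothesis z_lt_pinfty : forall u w k, (z u w k < +oo)%E.
Variables x th : R.
Hypothesis x_edge : forall k i, x < rationals R i ->
  P [set w | ((rationals R i)%:E <= z [::] w k)%E] = 0%E.

Lemma ae_le_edge k : \forall w \ae P, (z [::] w k <= x%:E)%E.
Proof.
pose F i := if x < rationals R i
  then [set w | ((rationals R i)%:E <= z [::] w k)%E] else set0.
apply: (@negligibleS _ _ _ P (\bigcup_i F i)).
  move=> w /negP; rewrite -ltNge => xz.
  suff [i /andP[xi iz]] : exists i, (x < rationals R i) && ((rationals R i)%:E <= z [::] w k)%E.
    by exists i => //; rewrite /F xi.
  case: (z [::] w k) xz (z_lt_pinfty [::] w k) => [r| |]//; rewrite lte_fin.
  by move=> /rationals_dense[i /andP[xi ir]] _; exists i; rewrite xi lee_fin ltW.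
apply: negligible_bigcup => i; rewrite /F; case: ifPn => xi; last exact: negligible_set0.
apply/negligibleP; last exact: x_edge.
have := emeasurable_fun_c_infty measurableT (z_measurable [::] k) (rationals R i)%:E.
by rewrite setTI.
Qed.

(** For a living child this is [exp ((th + n) (z - x))], which decreases almost surely in [n] to the
    indicator of [z = x]. Starting from [th] makes the integrals of [f 0] summable over the children
    when the transform is finite there. *)
Let f n k w : \bar R :=
  (expR_alive (th + n%:R) (z [::] w k) * expR (- ((th + n%:R) * x)))%:E.

Let f_ge0 n k w : (0 <= f n k w)%E.
Proof. by rewrite lee_fin mulr_ge0 ?expR_alive_ge0 ?expR_ge0. Qed.

Let mf n k : measurable_fun setT (f n k).
Proof.
apply/measurable_EFinP; apply: measurable_funM; last exact: measurable_cst.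
by exact: (measurableT_comp (measurable_expR_alive _) (z_measurable [::] k)).
Qed.

Let atom k := [set w | z [::] w k = x%:E].

Let matom k : measurable (atom k).
Proof.
rewrite -[X in measurable X]setTI.
exact: (z_measurable [::] k measurableT (emeasurable_set1 x%:E)).
Qed.

Let int_f n k : (\int[P]_w f n k w =
  (expR (- ((th + n%:R) * x)))%:E * child_moment P z (th + n%:R) k)%E.
Proof.
rewrite /f; under eq_integral do rewrite mulrC EFinM.
rewrite ge0_integralZl_EFin ?expR_ge0//.
- by move=> w _; rewrite lee_fin expR_alive_ge0.
- apply/measurable_EFinP.
  exact: (measurableT_comp (measurable_expR_alive _) (z_measurable [::] k)).
Qed.

Lemma expR_alive_tilt (theta : R) (r : R) :
  expR_alive theta r%:E * expR (- (theta * x)) = expR (theta * (r - x)).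
Proof. by rewrite /expR_alive/= -expRD mulrBr. Qed.

Let int_f_le n k : 0 <= th -> (\int[P]_w f n k w <= \int[P]_w f 0 k w)%E.
Proof.
move=> th0; apply: ae_ge0_le_integral => //.
apply: filterS (ae_le_edge k) => w zx _; rewrite lee_fin.
case: (z [::] w k) zx => [r| |]//; last by rewrite /expR_alive/= !mul0r.
rewrite lee_fin => rx; rewrite !expR_alive_tilt ler_expR ler_wnM2r ?subr_le0//.
by rewrite lerD2l ler_nat.
Qed.

Let cvg_int_f k : 0 <= th -> (\int[P]_w f n k w)%E @[n --> \oo] --> P (atom k).
Proof.
move=> th0.
have [|||_ _] := @dominated_convergence _ _ R P setT measurableT (f ^~ k)
  (fun w => (\1_(atom k) w)%:E) (EFin \o cst 1) (fun n => mf n k) _ _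
  (finite_measure_integrable_cst P 1 measurableT) _.
- by apply/measurable_EFinP; exact: measurable_indic.
- apply: filterS (ae_le_edge k) => w zx _.
  rewrite indicE; case zE: (z [::] w k) zx => [r| |]//; last first.
    move=> _; rewrite memNset; last by rewrite /atom/= zE.
    rewrite (_ : (fun n => f n k w) = cst 0%E); first exact: cvg_cst.
    by apply/funext => n; rewrite /f zE /expR_alive/= mul0r.
  rewrite lee_fin le_eqVlt => /orP[/eqP rx|rx].
    rewrite mem_set; last by rewrite /atom/= zE rx.
    rewrite (_ : (fun n => f n k w) = cst 1%E); first exact: cvg_cst.
    by apply/funext => n; rewrite /f zE rx expR_alive_tilt subrr mulr0 expR0.
  rewrite memNset; last by rewrite /atom/= zE => -[rx']; rewrite rx' ltxx in rx.
  rewrite /f zE.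
  apply: cvg_EFin; first exact: nearW.
  rewrite (_ : fine \o _ = geometric (expR (th * (r - x))) (expR (r - x))).
    by apply: cvg_geometric; rewrite gtr0_norm ?expR_gt0// -expR0 ltr_expR subr_lt0.
  apply/funext => n /=; rewrite expR_alive_tilt mulrDl [LHS]expRD; congr (_ * _).
  exact: expRM_natl.
- apply: filterS (ae_le_edge k) => w zx n _.
  rewrite gee0_abs//= lee_fin.
  case: (z [::] w k) zx => [r| |]//; last by rewrite /expR_alive/= !mul0r.
  rewrite lee_fin => rx; rewrite !expR_alive_tilt -expR0 ler_expR mulr_ge0_le0 ?subr_le0//.
  by rewrite addr_ge0.
by rewrite integral_indic// setIT.
Qed.

(** Let [theta = th + n] tend to infinity in the lower bound on [total_moment]. The limit is taken
    on finitely many children: the tail of the series at [n = 0] dominates the tails at all [n] and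
    costs at most half the gap [rho1 - rho]. *)
Lemma atom_mass (rho rho1 : R) : 0 <= th -> (total_moment P z th < +oo)%E -> rho < rho1 ->
    (forall theta, 0 <= theta -> ((rho1 * expR (theta * x))%:E <= total_moment P z theta)%E) ->
  exists K : nat, (rho%:E < \sum_(k < K) P (atom k))%E.
Proof.
move=> th0 fin rr hrho.
have s0 k : (0 <= \int[P]_w f 0 k w)%E by apply: integral_ge0.
have sE n : (\sum_(0 <= k <oo) \int[P]_w f n k w =
    (expR (- ((th + n%:R) * x)))%:E * total_moment P z (th + n%:R))%E.
  rewrite -nneseriesZl; last by move=> k _; exact: child_moment_ge0.
  by apply: eq_eseriesr => k _; exact: int_f.
have s_fin : (\sum_(0 <= k <oo) \int[P]_w f 0 k w < +oo)%E.
  by rewrite sE addr0 lte_mul_pinfty// ?lee_fin ?expR_ge0.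
have eps0 : 0 < (rho1 - rho) / 2 by lra.
have tail := nneseries_tail_cvg s_fin (fun k _ => s0 k).
have [K tailK] : exists K, (\sum_(K <= k <oo) \int[P]_w f 0 k w < ((rho1 - rho) / 2)%:E)%E.
  have : \forall K \near \oo, (\sum_(K <= k <oo) \int[P]_w f 0 k w < ((rho1 - rho) / 2)%:E)%E.
    have nb : nbhs 0%E [set u : \bar R | (u < ((rho1 - rho) / 2)%:E)%E].
      by apply: open_ereal_lt'; rewrite lte_fin.
    exact: (tail _ nb).
  by move=> [K _ /(_ K (leqnn _))]; exists K.
exists K.
have cv : (\sum_(k < K) \int[P]_w f n k w)%E @[n --> \oo] --> (\sum_(k < K) P (atom k))%E.
  apply: cvg_nnesum => k _; first by apply: nearW => n; exact: integral_ge0.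
  exact: cvg_int_f.
suff : ((rho1 - (rho1 - rho) / 2)%:E <= \sum_(k < K) P (atom k))%E.
  by apply: lt_le_trans; rewrite lte_fin; lra.
apply: (cvge_to_ge cv); apply: nearW => n.
have thn : 0 <= th + n%:R by rewrite addr_ge0.
have : (rho1%:E <= \sum_(0 <= k <oo) \int[P]_w f n k w)%E.
  rewrite sE expRN -lee_pdivrMl ?invr_gt0 ?expR_gt0// invrK -EFinM mulrC.
  exact: hrho.
rewrite (nneseries_split 0 K); last by move=> k _; apply: integral_ge0.
rewrite add0n big_mkord EFinB => h; rewrite leeBlDr// (le_trans h)//.
apply: leeD2l; apply: ltW; apply: le_lt_trans tailK.
apply: lee_nneseries => [k _ _|k _].
  by apply: integral_ge0 => w _; exact: f_ge0.
exact: int_f_le.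
Qed.

Lemma tail_geometric_edge (rho rho1 : R) : 0 <= th -> (total_moment P z th < +oo)%E ->
    0 < rho -> rho <= 1 -> rho < rho1 ->
    (forall theta, 0 <= theta -> ((rho1 * expR (theta * x))%:E <= total_moment P z theta)%E) ->
  tail_geometric P z x rho.
Proof.
move=> th0 fin r0 r1 rr hrho.
have [K rhoK] := atom_mass th0 fin rr hrho.
(* With the single threshold [x], every kept child is rounded to exactly [x] and all shifts vanish.
   The transform at 0 is then the mean number of kept children, and the indicator [phi] satisfies
   the linearised inequality with equality. *)
pose v (_ : nat) := x.
set wt := @level_weight _ _ _ P z v K 1; set sh := @level_shift _ x v K 1.
have wt_ge0 : forall j, 0 <= wt j := @level_weight_ge0 _ _ _ P z v K 1.
have sh0 j : wt j != 0 -> sh j = 0.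
  rewrite /wt /sh /level_weight /level_shift mulf_eq0 negb_or => /andP[_].
  rewrite /threshold_value big_mkcond big_ord_recl big_ord0 /=.
  case: ifP => _; last by rewrite maxxx eqxx/= eqxx.
  by rewrite maxeNy /= subrr.
pose phi (y : R) : R := if y <= 0 then 1 else 0.
have lt_rho : rho < laplace wt sh 0.
  rewrite -lte_fin (laplace_levelE z_measurable z_ident) mul0r oppr0 expR0 mul1e.
  apply: (lt_le_trans rhoK); apply: lee_sum => k _.
  rewrite -[atom k]setIT -(integral_indic P measurableT (matom k)).
  apply: ge0_le_integral => //.
  - by apply/measurable_EFinP; exact: measurable_indic.
  - apply/measurable_EFinP; apply: (measurableT_comp (measurable_expR_alive 0)).
    rewrite /trunc; under eq_fun do rewrite big_mkcond big_ord_recl big_ord0/=.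
    apply: measurable_maxe; last exact: measurable_cst.
    apply: measurable_fun_ifT; [|exact: measurable_cst|exact: measurable_cst].
    apply: (measurable_fun_bool true).
    have := emeasurable_fun_c_infty measurableT (z_measurable [::] k) x%:E.
    by rewrite setTI.
  move=> w _; rewrite indicE; case: (boolP (w \in atom k)) => [|_]; last first.
    by rewrite lee_fin expR_alive_ge0.
  rewrite inE /atom/= => ->; rewrite /trunc big_mkcond big_ord_recl big_ord0 lexx.
  by rewrite /= maxeNy /expR_alive/= mul0r expR0.
have [|||||c [c0 H]] := @tail_lower _ _ _ P z z_measurable z_indep z_ident z_lt_pinfty
    x v K 1 rho (laplace wt sh 0) 1 phi 0 1 r0 r1 lt_rho.
- by move=> y; rewrite /phi; case: ifP; rewrite ?lexx ler01.
- by rewrite /phi lexx ltr01.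
- move=> y; rewrite /laplace mulr_suml; apply: ler_sum => j _.
  rewrite mul0r expR0 mulr1 -/(wt j) -/(sh j).
  have [->|/sh0 ->] := eqVneq (wt j) 0; first by rewrite !mul0r.
  by rewrite subr0.
- exact: ltr01.
- by move=> y; rewrite mul1r mul0r add0r /survive/= /phi; case: ifP; lra.
by exists c, 0%N.
Qed.

End Edge.

(** * The rate of decay *)

Section Conclusion.
Variables (R : realType) (d : measure_display) (T : measurableType d).
Variables (P : probability T R) (z : vertex -> T -> nat -> \bar R).
Hypothesis z_measurable : forall u k, measurable_fun setT (fun w => z u w k).
Hypothesis z_indep : mutually_independent P (eval_sigma setT) z.
Hypothesis z_ident : forall u v, same_law P P (eval_sigma setT) (z u) (z v).
Hypothesis z_lt_pinfty : forall u w k, (z u w k < +oo)%E.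

Let tail n y := P [set w | (y%:E <= M z n w)%E].

Let tailE n y : exists2 p : R, 0 <= p & tail n y = p%:E.
Proof.
exists (fine (tail n y)); first exact: fine_ge0.
by rewrite fineK// fin_num_measure//; exact: measurable_M_tail.
Qed.

Lemma log_tail_rate_le x n : (0 < n)%N ->
  (log_tail_rate P z x n <= - psi_star P z x)%E.
Proof.
move=> n0; rewrite leeNr; apply: ge_ereal_sup => _ [theta /= t0 <-].
rewrite psiE//; have := total_moment_ge0 P z theta.
case E: (total_moment P z theta) => [e| |]// => [e0|_]; last by rewrite /= addeNy leNye.
have [p p0 pE] := tailE n (n%:R * x).
have := M_tail_upper z_measurable z_indep z_ident z_lt_pinfty n (n%:R * x) t0 E.
rewrite -/(tail n (n%:R * x)) pE lee_fin => pe.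
rewrite /log_tail_rate -/(tail n (n%:R * x)) pE.
have n0' : 0 < n%:R :> R by rewrite ltr0n.
have n1' : (0 < (n%:R^-1)%:E :> \bar R)%E by rewrite lte_fin invr_gt0.
have [->|pn0] := eqVneq p 0.
  by rewrite [lne 0%:E]le0_lneNy// gt0_muleNy//= leey.
have {}p0 : 0 < p by rewrite lt_def pn0.
have [e00|en0] := eqVneq e 0.
  by move: pe; rewrite e00 expr0n gtn_eqF//= mulr0 leNgt p0.
have {}e0 : 0 < e by rewrite lt_def en0 -lee_fin.
rewrite !lne_EFin// -EFinM -EFinB -EFinN lee_fin.
have : ln p <= - (theta * (n%:R * x)) + n%:R * ln e.
  rewrite -ler_expR lnK// (le_trans pe)// expRD expRM_natl lnK//.
have -> : - (theta * (n%:R * x)) + n%:R * ln e = n%:R * (ln e - theta * x) by ring.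
rewrite -ler_pdivrMl//; lra.
Qed.

Lemma total_moment_lower x (s theta : R) : (psi_star P z x <= s%:E)%E -> 0 <= theta ->
  ((expR (- s) * expR (theta * x))%:E <= total_moment P z theta)%E.
Proof.
move=> hs t0.
have : ((theta * x)%:E - psi P z theta <= s%:E)%E.
  by apply: le_trans hs; apply: ereal_sup_ubound; exists theta.
rewrite psiE//; have := total_moment_ge0 P z theta.
case: (total_moment P z theta) => [e| |]//; last by move=> _ _; rewrite leey.
(* A zero moment would make [psi] equal to -oo and [psi_star] infinite, against the bound by [s]. *)
rewrite lee_fin => e0; have [->|en0] := eqVneq e 0.
  by rewrite [lne _]le0_lneNy.
have {}e0 : 0 < e by rewrite lt_def en0.
rewrite lne_EFin// -EFinB !lee_fin => h.
by rewrite -(lnK e0) -expRD ler_expR; lra.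
Qed.

Lemma tail_geometric_below x (s rho theta0 : R) : (psi_star P z x <= s%:E)%E ->
    0 <= theta0 -> (total_moment P z theta0 < +oo)%E ->
    0 < rho -> rho <= 1 -> rho < expR (- s) ->
  tail_geometric P z x rho.
Proof.
move=> hs t0 tfin rho0 rho1 rhos.
have [h|h] := pselect (exists k i, x < rationals R i /\
   (0 < P [set w | ((rationals R i)%:E <= z [::] w k)%E])%E).
  apply: tail_geometric_above => // theta th.
  apply: lt_le_trans (total_moment_lower hs th).
  by rewrite lte_fin ltr_pM2r ?expR_gt0.
apply: (tail_geometric_edge z_measurable z_indep z_ident z_lt_pinfty _ t0 tfin) rhos _ => //.
  move=> k i xi; apply/eqP; rewrite eq_le measure_ge0 andbT leNgt; apply/negP => hp.
  by apply: h; exists k, i.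
by move=> theta; exact: total_moment_lower.
Qed.

Lemma log_tail_rate_ge x (s a theta0 : R) : (psi_star P z x <= s%:E)%E -> 0 <= s ->
    0 <= theta0 -> (total_moment P z theta0 < +oo)%E -> a < - s ->
  \forall n \near \oo, (a%:E <= log_tail_rate P z x n)%E.
Proof.
move=> hs s0 t0 tfin as_.
(* The midpoint of [a] and [- s]: being below [- s <= 0] it gives a rate [expR a1 <= 1], and its
   distance to [a] absorbs [ln c / n] once [n >= B]. *)
pose a1 := (a - s) / 2.
have a1s : a1 < - s by rewrite /a1; lra.
have a1a : a < a1 by rewrite /a1; lra.
have [||c [n0 [c0 H]]] := tail_geometric_below (rho := expR a1) hs t0 tfin (expR_gt0 _).
- by rewrite -expR0 ler_expR; lra.
- by rewrite ltr_expR.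
pose B := `|ln c| / (a1 - a).
near=> n.
have n0n : (n0 <= n)%N by near: n; exact: nbhs_infty_ge.
have npos : (0 < n)%N by near: n; exact: nbhs_infty_gt.
have nB : B <= n%:R.
  apply: (@le_trans _ _ (Num.bound B)%:R).
    by rewrite ltW// archi_boundP// divr_ge0// subr_ge0 ltW.
  by rewrite ler_nat; near: n; exact: nbhs_infty_ge.
have n0' : 0 < n%:R :> R by rewrite ltr0n.
have [p p0 pE] := tailE n (n%:R * x).
have := H n n0n; rewrite /log_tail_rate -/(tail n (n%:R * x)) pE lee_fin => cp.
have cpos : 0 < c * expR a1 ^+ n by rewrite mulr_gt0// exprn_gt0// expR_gt0.
have ppos : 0 < p by exact: lt_le_trans cp.
rewrite lne_EFin// -EFinM lee_fin mulrC ler_pdivlMr//.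
have : ln c + n%:R * a1 <= ln p.
  by rewrite -ler_expR (lnK ppos) expRD (lnK c0) expRM_natl.
rewrite /B ler_pdivrMr ?subr_gt0// in nB.
have := ler_norm (- ln c); rewrite normrN; lra.
Unshelve. all: by end_near. Qed.

Lemma cvg_log_tail_rate x (theta0 : R) : (0 <= psi_star P z x)%E ->
    0 <= theta0 -> (total_moment P z theta0 < +oo)%E ->
  log_tail_rate P z x n @[n --> \oo] --> (- psi_star P z x)%E.
Proof.
move=> s0 t0 tfin; have up := @log_tail_rate_le x.
(* If [psi_star] is infinite, the upper bound alone forces the rate to be -oo for every [n > 0]. *)
case E: (psi_star P z x) s0 up => [s| |]//; last first.
  move=> _ up; apply: (@cvg_trans _ (cst -oo%E @ \oo)); last exact: cvg_cst.
  apply: near_eq_cvg; near=> n; apply/esym/eqP; rewrite -leeNy_eq.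
  by apply: up; near: n; exact: nbhs_infty_gt.
rewrite lee_fin => s0 up.
have hs : (psi_star P z x <= s%:E)%E by rewrite E.
have low e : 0 < e -> \forall n \near \oo, ((- s - e)%:E <= log_tail_rate P z x n)%E.
  by move=> e0; apply: (log_tail_rate_ge hs s0 t0 tfin); lra.
apply: cvg_EFin.
  near=> n.
  have n1 : (log_tail_rate P z x n <= (- s)%:E)%E.
    by apply: up; near: n; exact: nbhs_infty_gt.
  have n2 : ((- s - 1)%:E <= log_tail_rate P z x n)%E by near: n; exact: low.
  by move: n1 n2; case: log_tail_rate.
apply/cvgrPdist_le => e e0; near=> n.
have n1 : (log_tail_rate P z x n <= (- s)%:E)%E.
  by apply: up; near: n; exact: nbhs_infty_gt.
have n2 : ((- s - e)%:E <= log_tail_rate P z x n)%E by near: n; exact: low.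
move: n1 n2 => /=; case: log_tail_rate => [r| |]//=; rewrite !lee_fin => n1 n2.
by rewrite ler_norml; lra.
Unshelve. all: by end_near. Qed.

End Conclusion.

Local Open Scope ereal_scope.

Theorem proposition1p1 (R : realType)
    (d : measure_display) (T : measurableType d) (P : probability T R)
    (d' : measure_display) (T' : measurableType d') (P' : probability T' R)
    (L : R.-ker T' ~> measurableTypeR R)
    (z : vertex -> T -> nat -> \bar R)
    (hz : reproduction_family P z P' L)
    (hsurv : P [set w | Z z 1 w setT = 0] < 1)
    (hpsi : exists theta : R, (0 < theta)%R /\ psi P z theta < +oo) :
  (0 < psi P z 0 ->
     forall x : R, x_star P z < x%:E ->
       log_tail_rate P z x n @[n --> \oo] --> - psi_star P z x) /\
  (psi P z 0 <= 0 ->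
     forall x : R, mean_position P z < x%:E ->
       log_tail_rate P z x n @[n --> \oo] --> - psi_star P z x).
Proof.
case: hz => _ zm zlt _ zi zid _.
have [theta0 [t0 psi_fin]] := hpsi.
have tfin : total_moment P z theta0 < +oo.
  move: psi_fin; rewrite (psiE P zm zlt).
  by case: (total_moment P z theta0) => [r _||]//; exact: ltry.
have cvg x (psx : 0 <= psi_star P z x) :=
  cvg_log_tail_rate zm zi zid zlt psx (ltW t0) tfin.
split=> [_ x|psi0 x _]; last first.
  (* The value at [theta = 0] gives [psi_star x >= - psi 0 >= 0]. *)
  apply: cvg; apply: (@le_trans _ _ ((0 * x)%:E - psi P z 0)).
    by rewrite mul0r add0e leeNr oppe0.
  by apply: ereal_sup_ubound; exists 0%R => //=; exact: lexx.
(* Some [theta > 0] has [psi theta / theta < x], so its term in the supremum defining [psi_star x]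
   is already positive. *)
move=> /ereal_inf_lt[_ [theta /= th <-] hx]; apply: cvg.
apply: (@le_trans _ _ ((theta * x)%:E - psi P z theta)); last first.
  by apply: ereal_sup_ubound; exists theta => //=; exact: ltW.
have : psi P z theta < (theta * x)%:E.
  by move: hx; rewrite inver gt_eqF// lte_pdivrMr// -EFinM mulrC.
case: (psi P z theta) => [r| |]//; last by move=> _; rewrite /= leey.
by rewrite lte_fin -EFinB lee_fin subr_ge0 => /ltW.
Qed.
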